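(* Fix $c>0$ and an integer $K\ge1$, and let $p_n=c/n$. For the Tetris exploration algorithm on $n$ vertices (described in the context), let $A_k(t)=|\mathcal{A}_k(t)|$ and $\alpha^n_k(t)=A_k(\lfloor nt\rfloor)/n$ for $t\in[0,1]$, $1\le k\le K$, and $\boldsymbol\alpha^n(t)=(\alpha_1^n(t),\dots,\alpha^n_K(t))$. For $\boldsymbol\alpha=(\alpha_1,\dots,\alpha_K)$ define $$\delta_1(\boldsymbol\alpha)=e^{-c(\alpha_1+\dots+\alpha_K)},\qquad \delta_k(\boldsymbol\alpha)=\big(1-e^{-c\alpha_{k-1}}\big)e^{-c(\alpha_k+\dots+\alpha_K)}\ \ (2\le k\le K).$$ Then the integral equations $\alpha_k(t)=\int_0^t\delta_k(\boldsymbol\alpha(s))\,ds$, $1\le k\le K$, $t\in[0,1]$, have a unique solution $\boldsymbol\alpha(t)$, and the process $\{\boldsymbol\alpha^n(t)\}_{0\le t\le1}$ converges in distribution (uniformly on $[0,1]$) to the deterministic process $\{\boldsymbol\alpha(t)\}_{0\le t\le1}$. Consequently, if $N_k(n)$ denotes the number of vertices at height $k$ in the final state of the Tetris model on $G(n,c/n)$, then for all $1\le k\le K$, $N_k(n)/n\to\alpha_k(1)$ in distribution as $n\to\infty$.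
   Context: $G(n,p_n)$ is the Erdős–Rényi random graph on $[n]$ with independent edge probability $p_n$. Tetris model: given $G(n,p_n)$, set $h_v(0)=0$ for all $v$. At step $t+1$ a vertex $u$ is chosen uniformly at random among vertices not selected before; with $m$ the maximum of $h_w(t)$ over neighbours $w$ of $u$ ($m=0$ if none), set $h_u(t+1)=m+1$ if $m<K$ and $h_u(t+1)=0$ otherwise. After $n$ steps, $N_k(n)=|\{v:h_v(n)=k\}|$. Tetris exploration algorithm: maintain $\mathcal{A}_k(t)$, $0\le k\le K$ (explored vertices at height $k$; height $0$ = frozen) and unexplored set $\mathcal{U}(t)$, initially empty and $[n]$ respectively. At step $t+1$, select $v\in\mathcal{U}(t)$ uniformly, remove it from $\mathcal{U}$, join it to each explored vertex independently with probability $p_n$; if $j$ is the maximal height among explored vertices joined to $v$ ($j=0$ if none) and $j\le K-1$, then $v$ joins $\mathcal{A}_{j+1}$, otherwise $v$ joins $\mathcal{A}_0$. Convergence in distribution of processes is understood as uniform convergence over compact sets. *)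

(* Defs.v *)
From HB Require Import structures.
From mathcomp Require Import all_boot all_order all_algebra all_fingroup.
From mathcomp Require Import all_classical all_reals all_analysis.
Set Implicit Arguments. Unset Strict Implicit. Unset Printing Implicit Defensive.
Import Order.TTheory GRing.Theory Num.Theory.
Import numFieldNormedType.Exports.

Local Open Scope ring_scope.

(* Sample space for n vertices: a uniform ordering sigma of [n]        *)
(* (sigma t is the vertex selected at step t+1; a uniform permutation   *)
(* is the same as successively choosing a uniform not-yet-selected     *)
(* vertex) together with the edge indicators e of G(n,p): e (i,j)      *)
(* for i < j is the indicator of the edge {i,j}; the entries with      *)
(* ~ (i < j) are forced to false.                                      *)
Definition omega (n : nat) : finType :=
  ({perm 'I_n} * {ffun 'I_n * 'I_n -> bool})%type.

Definition adj n (e : {ffun 'I_n * 'I_n -> bool}) (u w : 'I_n) : bool :=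
  if (u < w)%N then e (u, w) else if (w < u)%N then e (w, u) else false.

Definition weight {R : realType} (n : nat) (p : R) (w : omega n) : R :=
  (n`!%:R)^-1 *
  \prod_(ij : 'I_n * 'I_n)
     (if (ij.1 < ij.2)%N then (if w.2 ij then p else 1 - p)
      else (if w.2 ij then 0 else 1)).

Definition Ex {R : realType} (n : nat) (p : R) (X : omega n -> R) : R :=
  \sum_(w : omega n) weight p w * X w.

(* Tetris exploration algorithm.  State = (set of explored vertices,   *)
(* height function); the height of an explored vertex is its k with    *)
(* v in A_k (height 0 = frozen).                                       *)
Definition expl_step n (K : nat) (w : omega n) (t : nat)
    (s : {set 'I_n} * {ffun 'I_n -> nat}) : {set 'I_n} * {ffun 'I_n -> nat} :=
  match @insub nat (fun m => (m < n)%N) 'I_n t with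
  | Some i =>
      let v := w.1 i in
      let j := \max_(x in s.1 | adj w.2 v x) s.2 x in
      let hv := if (j <= K.-1)%N then j.+1 else 0%N in
      (v |: s.1, [ffun x => if x == v then hv else s.2 x])
  | None => s
  end.

Fixpoint expl_state n (K : nat) (w : omega n) (t : nat)
    : {set 'I_n} * {ffun 'I_n -> nat} :=
  match t with
  | 0 => (finset.set0 : {set 'I_n}, [ffun => 0%N])
  | t'.+1 => expl_step K w t' (expl_state K w t')
  end.

Definition A_count n (K : nat) (w : omega n) (k t : nat) : nat :=
  #|[set v in (expl_state K w t).1 | (expl_state K w t).2 v == k]|.

Definition alpha_n {R : realType} n (K : nat) (w : omega n) (k : nat) (t : R) : R :=
  (A_count K w k (Num.truncn (n%:R * t)))%:R / n%:R.

Definition tetris_step n (K : nat) (w : omega n) (t : nat)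
    (h : {ffun 'I_n -> nat}) : {ffun 'I_n -> nat} :=
  match @insub nat (fun m => (m < n)%N) 'I_n t with
  | Some i =>
      let u := w.1 i in
      let m := \max_(x | adj w.2 u x) h x in
      let hu := if (m < K)%N then m.+1 else 0%N in
      [ffun x => if x == u then hu else h x]
  | None => h
  end.

Fixpoint tetris_h n (K : nat) (w : omega n) (t : nat) : {ffun 'I_n -> nat} :=
  match t with
  | 0 => [ffun => 0%N]
  | t'.+1 => tetris_step K w t' (tetris_h K w t')
  end.

Definition N_count n (K : nat) (w : omega n) (k : nat) : nat :=
  #|[set v | tetris_h K w n v == k]|.

Definition delta {R : realType} (c : R) (K k : nat) (a : nat -> R) : R :=
  if k == 1%N then expR (- c * \sum_(1 <= i < K.+1) a i)
  else (1 - expR (- c * a k.-1)) * expR (- c * \sum_(k <= i < K.+1) a i).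

Definition solves_int_eq {R : realType} (c : R) (K : nat) (b : nat -> R -> R) : Prop :=
  forall k, (1 <= k <= K)%N ->
    (lebesgue_measure.-integrable `[0%R, 1%R]%classic
       (fun s => (delta c K k (fun i => b i s))%:E)) /\
    forall t, 0 <= t <= 1 ->
      (b k t)%:E = (\int[lebesgue_measure]_(s in `[0%R, t]%classic)
                      (delta c K k (fun i => b i s))%:E)%E.

Definition unif_continuous_functional {R : realType} (K : nat)
    (F : (nat -> R -> R) -> R) : Prop :=
  forall f (eps : R), 0 < eps -> exists2 d : R, 0 < d &
    forall g, (forall k t, (1 <= k <= K)%N -> 0 <= t <= 1 -> `|f k t - g k t| < d) ->
      `|F f - F g| < eps.

(* Main.v *)
(* In the variables tail_k = a_k + ... + a_K the drift is a difference of two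
   exponentials, delta_k = exp(-c tail_k) - exp(-c tail_(k-1)), hence bounded by
   1 and Lipschitz on the positive orthant.  A path solves the integral equations
   iff its increments over [s, t] agree with (t - s) delta(a(s)) up to
   O((t - s)^2); a discrete Gronwall inequality then gives uniqueness, and
   existence by letting the mesh of the Euler scheme tend to 0 along powers of 2.
   For the random process fix the selection order and average over the edges only:
   the edges from the selected vertex to the explored set are fresh, and the
   probability that none of them meets a set T is (1 - p)^|T|, so the one-step drift
   is delta up to O(1/n).  The mean square distance V(t) between the process and the
   flow satisfies V(t+1) <= (1 + L/n) V(t) + C/n^2, so V = O(1/n) uniformly in t.
   Chebyshev at a fixed finite grid of times, together with the Lipschitz bound of
   both paths, yields uniform convergence in probability. *)
Require Import Defs.
From HB Require Import structures.
From mathcomp Require Import all_boot all_order all_algebra all_fingroup.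
From mathcomp Require Import all_classical all_reals all_analysis.
From mathcomp Require Import ring lra zify.
Import Order.TTheory GRing.Theory Num.Theory.
Import numFieldNormedType.Exports.
Local Open Scope classical_set_scope.
Local Open Scope ring_scope.

(** * Drift and discrete Gronwall inequality *)

Definition l1 {R : realType} (K : nat) (a b : nat -> R) : R :=
  \sum_(1 <= i < K.+1) `|a i - b i|.

Definition nonneg {R : realType} (K : nat) (a : nat -> R) : Prop :=
  forall k, (1 <= k <= K)%N -> 0 <= a k.

(** For [x <= y], factor out [exp(-x) <= 1] and bound [1 - exp(-(y - x))] by [y - x]. *)
Lemma expRN_lipschitz {R : realType} (x y : R) : 0 <= x -> 0 <= y ->
  `|expR (- x) - expR (- y)| <= `|x - y|.
Proof.
wlog xy : x y / x <= y.
  by move=> H x0 y0; have [/H|/ltW/H] := leP x y; [exact|rewrite distrC (distrC x); exact].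
move=> x0 y0; have e1 : expR (- x) <= 1 by rewrite -expR0 ler_expR oppr_le0.
have e0 := expR_gt0 (- x).
have ee : expR (- y) = expR (- x) * expR (- (y - x)).
  by rewrite -expRD; congr expR; ring.
have := expR_ge1Dx (- (y - x)) => h.
have em : expR (- y) <= expR (- x) by rewrite ler_expR lerN2.
rewrite ger0_norm ?subr_ge0// ler0_norm ?subr_le0// ee; nra.
Qed.

(** Expanding the factor [1 - exp(-c a_(k-1))] moves [a_(k-1)] into the tail sum. At [k = 1] the
    drift has no such factor, whence the subtracted 0. *)
Lemma delta_tail {R : realType} (c : R) (K k : nat) (a : nat -> R) :
  (1 <= k <= K)%N ->
  delta c K k a = expR (- (c * \sum_(k <= i < K.+1) a i)) -
    (if k == 1%N then 0 else expR (- (c * \sum_(k.-1 <= i < K.+1) a i))).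
Proof.
move=> /andP[k1 kK]; rewrite /delta; case: eqP => [->|kn1]; first by rewrite subr0 mulNr.
have k2 : (1 < k)%N by lia.
rewrite [in RHS](@big_ltn _ _ _ k.-1); last by lia.
rewrite prednK; last by lia.
by rewrite mulrDr opprD expRD mulrBl mul1r !mulNr.
Qed.

Lemma sum_nat_ge0 {R : realType} (K k : nat) (a : nat -> R) : (1 <= k)%N ->
  nonneg K a -> 0 <= \sum_(k <= i < K.+1) a i.
Proof.
move=> k1 a0; rewrite big_nat; apply: sumr_ge0 => i /andP[ki iK].
by apply: a0; lia.
Qed.

Lemma tail_l1 {R : realType} (K k : nat) (a b : nat -> R) : (1 <= k <= K)%N ->
  `|\sum_(k <= i < K.+1) a i - \sum_(k <= i < K.+1) b i| <= l1 K a b.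
Proof.
move=> /andP[k1 kK]; rewrite -sumrB (le_trans (ler_norm_sum _ _ _))//.
rewrite /l1 (@big_cat_nat _ _ _ k 1 K.+1)//=; last by lia.
by rewrite lerDr; apply: sumr_ge0.
Qed.

(** Each of the two exponentials of [delta_tail] moves by at most [c] times the distance of the
    arguments. *)
Lemma delta_lipschitz {R : realType} (c : R) (K k : nat) (a b : nat -> R) :
  0 < c -> (1 <= k <= K)%N -> nonneg K a -> nonneg K b ->
  `|delta c K k a - delta c K k b| <= 2 * c * l1 K a b.
Proof.
move=> c0 kK a0 b0.
have H j : (1 <= j <= K)%N ->
    `|expR (- (c * \sum_(j <= i < K.+1) a i)) -
      expR (- (c * \sum_(j <= i < K.+1) b i))| <= c * l1 K a b.
  move=> jK; have /andP[j1 _] := jK.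
  have := expRN_lipschitz (c * \sum_(j <= i < K.+1) a i) (c * \sum_(j <= i < K.+1) b i).
  rewrite -mulrBr normrM (gtr0_norm c0) => /(_ _ _)/le_trans; apply.
  - by rewrite mulr_ge0 ?sum_nat_ge0// ltW.
  - by rewrite mulr_ge0 ?sum_nat_ge0// ltW.
  - by rewrite ler_pM2l// tail_l1.
have L0 : 0 <= c * l1 K a b by rewrite mulr_ge0 ?(ltW c0)//; apply: sumr_ge0.
rewrite !delta_tail//; have := H k kK; case: eqP => k1.
  rewrite !subr0 => /le_trans; apply; lra.
have : (1 <= k.-1 <= K)%N by lia.
move=> /H; rewrite !ler_norml; lra.
Qed.

Lemma delta_itv {R : realType} (c : R) (K k : nat) (a : nat -> R) :
  0 < c -> (1 <= k <= K)%N -> nonneg K a -> 0 <= delta c K k a <= 1.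
Proof.
move=> c0 kK a0.
have E (x : R) : 0 <= x -> 0 < expR (- c * x) <= 1.
  move=> x0; rewrite expR_gt0/= -expR0 ler_expR mulNr oppr_le0 mulr_ge0//; lra.
have T j : (1 <= j)%N -> 0 < expR (- c * \sum_(j <= i < K.+1) a i) <= 1.
  by move=> j1; apply: E; rewrite sum_nat_ge0.
rewrite /delta; case: eqP => k1; first by have := T 1%N isT; lra.
have /andP[] := T k ltac:(lia); have /andP[] : 0 < expR (- c * a k.-1) <= 1.
  by apply: E; apply: a0; lia.
set x := expR _; set y := expR _ => *; nra.
Qed.

(** Unrolling [i] steps accumulates [i] errors [C h^2], each amplified by at most [(1 + L h)^i].
    Since [N h <= 1], the amplification stays below [exp L] and the errors add up to at most
    [C h]. *)
Lemma discrete_gronwall {R : realType} (u : nat -> R) (L C h : R) (N : nat) :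
  0 <= L -> 0 <= C -> 0 <= h -> N%:R * h <= 1 -> u 0%N <= 0 ->
  (forall i, (i < N)%N -> u i.+1 <= (1 + L * h) * u i + C * h ^+ 2) ->
  u N <= C * expR L * h.
Proof.
move=> L0 C0 h0 Nh u0 H.
have P i : 1 <= (1 + L * h) ^+ i by rewrite exprn_ege1// lerDl mulr_ge0.
have S i : (i <= N)%N -> u i <= (1 + L * h) ^+ i * (i%:R * (C * h ^+ 2)).
  elim: i => [|i IH] iN; first by rewrite mul0r mulr0.
  apply: (le_trans (H i iN)).
  rewrite -[in leRHS]natr1 [X in _ <= _ * X]mulrDl mul1r mulrDr; apply: lerD.
    by rewrite exprS -mulrA ler_wpM2l ?IH 1?ltnW// addr_ge0 ?mulr_ge0.
  by rewrite ler_peMl ?mulr_ge0 ?exprn_ge0.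
apply: (le_trans (S N (leqnn _))).
have h1 : (1 + L * h) ^+ N <= expR L.
  apply: (@le_trans _ _ (expR (L * h) ^+ N)).
    by rewrite lerXn2r ?nnegrE ?expR_ge0 ?expR_ge1Dx// addr_ge0 ?mulr_ge0.
  by rewrite -expRM_natl ler_expR -[leRHS]mulr1 mulrCA ler_wpM2l.
have h2 : N%:R * (C * h ^+ 2) <= C * h.
  by rewrite mulrCA ler_wpM2l// expr2 mulrA ler_piMl.
rewrite [C * expR L]mulrC -[leRHS]mulrA; apply: ler_pM => //; first exact: le_trans (P N).
by rewrite !mulr_ge0 ?exprn_ge0.
Qed.

(** * Flows and the integral equations *)

Lemma le0_of_le_divS {R : realType} (x B : R) :
  (forall N : nat, x <= B / N.+1%:R) -> x <= 0.
Proof.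
move=> H; have [//|x0] := leP x 0.
have := H (Num.truncn (B / x)); rewrite ler_pdivlMr ?ltr0Sn//.
have := truncnS_gt (B / x); rewrite ltr_pdivrMr//; nra.
Qed.

Lemma sum_nat1_const {R : realType} (K : nat) (x : R) :
  \sum_(1 <= i < K.+1) x = K%:R * x.
Proof. by rewrite sumr_const_nat subn1 mulr_natl. Qed.

Lemma ler_term_sum {R : realType} (m N j : nat) (f : nat -> R) : (m <= j < N)%N ->
  (forall i, 0 <= f i) -> f j <= \sum_(m <= i < N) f i.
Proof.
move=> jN f0; rewrite (bigD1_seq j) ?iota_uniq ?mem_index_iota//=.
by rewrite lerDl sumr_ge0.
Qed.

Lemma ler_l1 {R : realType} (K k : nat) (a b : nat -> R) : (1 <= k <= K)%N ->
  `|a k - b k| <= l1 K a b.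
Proof.
by move=> kK; apply: (ler_term_sum 1 K.+1 k (fun i => `|a i - b i|)).
Qed.

Lemma l1_le {R : realType} (K : nat) (a b : nat -> R) (x : R) :
  (forall k, (1 <= k <= K)%N -> `|a k - b k| <= x) -> l1 K a b <= K%:R * x.
Proof.
move=> H; rewrite -sum_nat1_const /l1 !big_nat; apply: ler_sum => i iK.
by apply: H; lia.
Qed.

(** Per step the Lipschitz drift multiplies the distance by at most [1 + 2 c K h], and the two local
    errors add [2 K C h^2] over the [K] coordinates. This serves both for flows sampled on a grid
    and for Euler schemes of two meshes. *)
Lemma euler_compare {R : realType} (c : R) (K : nat) (x y : nat -> nat -> R)
    (C h : R) (N : nat) :
  0 < c -> 0 <= C -> 0 <= h -> N%:R * h <= 1 ->
  (forall k, (1 <= k <= K)%N -> x 0%N k = y 0%N k) ->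
  (forall i, (i <= N)%N -> nonneg K (x i) /\ nonneg K (y i)) ->
  (forall i k, (i < N)%N -> (1 <= k <= K)%N ->
    `|x i.+1 k - x i k - h * delta c K k (x i)| <= C * h ^+ 2 /\
    `|y i.+1 k - y i k - h * delta c K k (y i)| <= C * h ^+ 2) ->
  l1 K (x N) (y N) <= 2 * K%:R * C * expR (2 * c * K%:R) * h.
Proof.
move=> c0 C0 h0 Nh xy0 xy1 H.
apply: (@discrete_gronwall R (fun i => l1 K (x i) (y i))) => //.
- by rewrite !mulr_ge0// ltW.
- by rewrite !mulr_ge0.
- rewrite /l1 big_nat big1// => i iK; rewrite xy0 ?subrr ?normr0//; lia.
move=> i iN; set u := l1 K (x i) (y i).
have [x0 y0] := xy1 i (ltnW iN).
apply: (@le_trans _ _ (\sum_(1 <= k < K.+1) (`|x i k - y i k| + (h * (2 * c * u) + 2 * C * h ^+ 2)))).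
  rewrite /l1 !big_nat; apply: ler_sum => k kK'.
  have kK : (1 <= k <= K)%N by lia.
  have [hx hy] := H i k iN kK.
  have := delta_lipschitz c K k (x i) (y i) c0 kK x0 y0; rewrite -/u => hd.
  have hd' : `|h * (delta c K k (x i) - delta c K k (y i))| <= h * (2 * c * u).
    by rewrite normrM ger0_norm// ler_wpM2l.
  have -> : x i.+1 k - y i.+1 k = (x i k - y i k) +
    ((x i.+1 k - x i k - h * delta c K k (x i)) -
     (y i.+1 k - y i k - h * delta c K k (y i)) +
    h * (delta c K k (x i) - delta c K k (y i))) by ring.
  apply: (le_trans (ler_normD _ _)); rewrite lerD2l.
  apply: (le_trans (ler_normD _ _)); rewrite addrC; apply: lerD => //.
  apply: (le_trans (ler_normB _ _)); lra.
rewrite big_split/= sum_nat1_const -/(l1 K (x i) (y i)) -/u le_eqVlt.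
by apply/orP; left; apply/eqP; ring.
Qed.

(* An integral-free form of the equations: the quadratic error term makes [a]
   comparable with Euler polygons. *)
Definition is_flow {R : realType} (c : R) (K : nat) (a : nat -> R -> R) : Prop :=
  [/\ forall k, (1 <= k <= K)%N -> a k 0 = 0,
      forall t, 0 <= t <= 1 -> nonneg K (a^~ t),
      forall k s t, (1 <= k <= K)%N -> 0 <= s -> s <= t -> t <= 1 ->
        `|a k t - a k s| <= t - s
    & forall k s t, (1 <= k <= K)%N -> 0 <= s -> s <= t -> t <= 1 ->
        `|a k t - a k s - (t - s) * delta c K k (a^~ s)|
          <= 2 * c * K%:R * (t - s) ^+ 2].

Lemma grid_itv {R : realType} (t : R) (N i : nat) : 0 <= t <= 1 -> (i <= N.+1)%N ->
  0 <= i%:R * (t / N.+1%:R) <= 1.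
Proof.
move=> /andP[t0 t1] iN; rewrite mulr_ge0 ?divr_ge0//= mulrA ler_pdivrMr ?ltr0Sn// mul1r.
have : (i%:R : R) <= N.+1%:R by rewrite ler_nat.
have : (0 : R) <= i%:R by []; nra.
Qed.

(** Sampled at [N+1] equal steps up to [t], each flow is an Euler scheme with local error constant
    [2 c K], so the two differ by [O(1/N)]. *)
Lemma flow_unique {R : realType} (c : R) (K : nat) (a b : nat -> R -> R) :
  0 < c -> is_flow c K a -> is_flow c K b ->
  forall k t, (1 <= k <= K)%N -> 0 <= t <= 1 -> a k t = b k t.
Proof.
move=> c0 [a0 a1 _ a2] [b0 b1 _ b2] k t kK t01.
apply/eqP; rewrite -subr_eq0 -normr_le0; apply/eqP.
apply/eqP; apply: (@le0_of_le_divS R _ (2 * K%:R * (2 * c * K%:R) * expR (2 * c * K%:R))) => N.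
apply: (le_trans (ler_l1 K k (a^~ t) (b^~ t) kK)).
have h0 : 0 <= t / N.+1%:R by rewrite divr_ge0//; case/andP: t01.
have tN : N.+1%:R * (t / N.+1%:R) = t by rewrite mulrC divfK// pnatr_eq0.
apply: (@le_trans _ _ (2 * K%:R * (2 * c * K%:R) * expR (2 * c * K%:R) * (t / N.+1%:R))).
  rewrite -[X in l1 K (a^~ X) _]tN -[X in l1 K _ (b^~ X)]tN.
  apply: (@euler_compare R c K (fun i => a^~ (i%:R * (t / N.+1%:R)))
            (fun i => b^~ (i%:R * (t / N.+1%:R)))) => //.
  - by rewrite !mulr_ge0// ltW.
  - by rewrite tN; case/andP: t01.
  - by move=> j jK; rewrite !mul0r a0// b0.
  - by move=> i iN; split; [apply: a1|apply: b1]; apply: grid_itv.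
  - move=> i j iN jK.
    have st : i.+1%:R * (t / N.+1%:R) - i%:R * (t / N.+1%:R) = t / N.+1%:R.
      by rewrite -mulrBl -natrB// subSnn mul1r.
    have /andP[i0 _] := grid_itv t N i t01 (ltnW iN).
    have /andP[_ i1] := grid_itv t N i.+1 t01 iN.
    have ii : i%:R * (t / N.+1%:R) <= i.+1%:R * (t / N.+1%:R) by rewrite -subr_ge0 st.
    by split; have := (a2 j _ _ jK i0 ii i1, b2 j _ _ jK i0 ii i1); rewrite st => -[].
by rewrite ler_wpM2l ?mulr_ge0 ?expR_ge0 ?(ltW c0)// ler_piMl ?invr_ge0//; case/andP: t01.
Qed.

(** The interval is open at [s] because it arises by removing [[0, s]] from [[0, t]]. *)
Lemma Rintegral_itv_bounds {R : realType} (g : R -> R) (m M s t : R) : s <= t ->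
  lebesgue_measure.-integrable `]s, t] (EFin \o g) ->
  (forall x, s < x <= t -> m <= g x <= M) ->
  m * (t - s) <= (\int[lebesgue_measure]_(x in `]s, t]) g x) <= M * (t - s).
Proof.
move=> st gi H.
have mu : lebesgue_measure `]s, t] = (t - s)%:E :> \bar R.
  rewrite lebesgue_measure_itv/= lte_fin; case: ltgtP st => // -> _.
  by rewrite subrr.
have Hc (r : R) : r * (t - s) = \int[lebesgue_measure]_(x in `]s, t]) r.
  by rewrite Rintegral_cst//= mu.
have ci (r : R) : lebesgue_measure.-integrable `]s, t] (EFin \o (fun _ : R => r)).
  apply/integrableP; split; first exact: measurable_cst.
  by rewrite /= integral_cst//= [X in (_ * X)%E]mu -EFinM ltry.
by rewrite !Hc !le_Rintegral// => x /=; rewrite in_itv/= => /H/andP[].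
Qed.

(** [N+1] increments of order [1/N^2] add up to order [1/N]: this is the Gronwall inequality with
    [L = 0]. *)
Lemma flat_of_quadratic_increments {R : realType} (D : R -> R) (C : R) :
  0 <= C -> D 0 = 0 ->
  (forall s t : R, 0 <= s -> s <= t -> t <= 1 -> `|D t - D s| <= C * (t - s) ^+ 2) ->
  forall t : R, 0 <= t <= 1 -> D t = 0.
Proof.
move=> C0 D0 H t t01; apply/eqP; rewrite -normr_le0.
apply: (@le0_of_le_divS R _ C) => N.
have h0 : 0 <= t / N.+1%:R by rewrite divr_ge0//; case/andP: t01.
have tN : N.+1%:R * (t / N.+1%:R) = t by rewrite mulrC divfK// pnatr_eq0.
apply: (@le_trans _ _ (C * expR 0 * (t / N.+1%:R))); last first.
  by rewrite expR0 mulr1 ler_wpM2l// ler_piMl ?invr_ge0//; case/andP: t01.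
rewrite -[X in D X]tN.
apply: (@discrete_gronwall R (fun i => `|D (i%:R * (t / N.+1%:R))|)) => //.
- by rewrite tN; case/andP: t01.
- by rewrite mul0r D0 normr0.
move=> i iN; rewrite mul0r addr0 mul1r.
have st : i.+1%:R * (t / N.+1%:R) - i%:R * (t / N.+1%:R) = t / N.+1%:R.
  by rewrite -mulrBl -natrB// subSnn mul1r.
have /andP[i0 _] := grid_itv t N i t01 (ltnW iN).
have /andP[_ i1] := grid_itv t N i.+1 t01 iN.
have ii : i%:R * (t / N.+1%:R) <= i.+1%:R * (t / N.+1%:R) by rewrite -subr_ge0 st.
have := H _ _ i0 ii i1; rewrite st.
have := ler_normD (D (i%:R * (t / N.+1%:R)))
   (D (i.+1%:R * (t / N.+1%:R)) - D (i%:R * (t / N.+1%:R))).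
by rewrite subrKC => /le_trans + h; apply; rewrite lerD2l.
Qed.

Lemma Rintegral_increment {R : realType} (g : R -> R) (s t : R) :
  lebesgue_measure.-integrable `[0, 1] (EFin \o g) ->
  0 <= s -> s <= t -> t <= 1 ->
  [/\ lebesgue_measure.-integrable `[0, t] (EFin \o g),
      lebesgue_measure.-integrable `]s, t] (EFin \o g) &
  (\int[lebesgue_measure]_(x in `[0, t]) g x) -
  (\int[lebesgue_measure]_(x in `[0, s]) g x) =
  \int[lebesgue_measure]_(x in `]s, t]) g x].
Proof.
move=> gi s0 st t1.
have gt : lebesgue_measure.-integrable `[0, t] (EFin \o g).
  apply: integrableS gi => //; apply: subset_itvl; rewrite bnd_simp//.
split=> //.
- apply: integrableS gt => //; apply: subset_itvr; rewrite bnd_simp//.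
- by rewrite Rintegral_itvB// bnd_simp.
Qed.

Lemma delta_path_lipschitz {R : realType} (c : R) (K k : nat) (a : nat -> R -> R) (s t : R) :
  0 < c -> (1 <= k <= K)%N ->
  (forall t, 0 <= t <= 1 -> nonneg K (a^~ t)) ->
  (forall k s t, (1 <= k <= K)%N -> 0 <= s -> s <= t -> t <= 1 ->
        `|a k t - a k s| <= t - s) ->
  0 <= s -> s <= t -> t <= 1 ->
  `|delta c K k (a^~ t) - delta c K k (a^~ s)| <= 2 * c * K%:R * (t - s).
Proof.
move=> c0 kK a0 al s0 st t1.
have sI : 0 <= s <= 1 by lra.
have tI : 0 <= t <= 1 by lra.
apply: (le_trans (delta_lipschitz c K k _ _ c0 kK (a0 _ tI) (a0 _ sI))).
rewrite -[leRHS]mulrA ler_wpM2l//; first by rewrite mulr_ge0// ltW.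
by apply: l1_le => j jK; apply: al.
Qed.

Lemma solution_flow {R : realType} (c : R) (K : nat) (b : nat -> R -> R) :
  0 < c -> solves_int_eq c K b -> is_flow c K b.
Proof.
move=> c0 H; set g := fun k s => delta c K k (fun i => b i s).
have bE k t : (1 <= k <= K)%N -> 0 <= t <= 1 ->
    b k t = \int[lebesgue_measure]_(s in `[0, t]) g k s.
  by move=> kK t01; have [_ /(_ t t01) bt] := H k kK; rewrite /Rintegral /g -bt.
have b0 k : (1 <= k <= K)%N -> b k 0 = 0.
  by move=> kK; rewrite bE ?lexx ?ler01// set_itv1 Rintegral_set1.
have bI k s t m M : (1 <= k <= K)%N -> 0 <= s -> s <= t -> t <= 1 ->
    (forall x, s < x <= t -> m <= g k x <= M) ->
    m * (t - s) <= b k t - b k s <= M * (t - s).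
  move=> kK s0 st t1 gmM; have [gi _] := H k kK.
  have sI : 0 <= s <= 1 by lra.
  have tI : 0 <= t <= 1 by lra.
  have [_ gst] := Rintegral_increment (g k) s t gi s0 st t1.
  rewrite -(bE k t kK tI) -(bE k s kK sI) => ->.
  exact: Rintegral_itv_bounds.
(* Induction on the level, as the sign of [delta_k] depends on [b_(k-1)] alone. This comes first:
   the bounds on [delta] are stated on the positive orthant. *)
have bn t : 0 <= t <= 1 -> nonneg K (b^~ t).
  move=> + k; elim: k t => [//|k IH] t t01 kK.
  rewrite bE//; apply: Rintegral_ge0 => // x /=; rewrite in_itv/= => /andP[x0 xt].
  rewrite /g /delta; case: eqP => k1; rewrite ?expR_ge0// mulr_ge0 ?expR_ge0//.
  rewrite subr_ge0 -expR0 ler_expR mulNr oppr_le0 mulr_ge0 ?(ltW c0)// IH//; [lra|lia].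
have bl k s t : (1 <= k <= K)%N -> 0 <= s -> s <= t -> t <= 1 ->
    `|b k t - b k s| <= t - s.
  move=> kK s0 st t1; have /andP[l u] : 0 * (t - s) <= b k t - b k s <= 1 * (t - s).
    apply: bI => // x sxt; apply: delta_itv => //; apply: bn; lra.
  rewrite ger0_norm; lra.
split=> // k s t kK s0 st t1.
(* [C] bounds the oscillation of the drift on [[s, t]] around its value [d], so the increment is
   within [C (t - s)] of [d (t - s)]. *)
set d := delta c K k (b^~ s); set C := 2 * c * K%:R * (t - s).
have /andP[l u] : (d - C) * (t - s) <= b k t - b k s <= (d + C) * (t - s).
  apply: bI => // x /andP[sx xt].
  have := @delta_path_lipschitz R c K k b s x c0 kK bn bl s0 (ltW sx) (le_trans xt t1).
  have : 2 * c * K%:R * (x - s) <= C by rewrite ler_wpM2l ?mulr_ge0 ?(ltW c0)//; lra.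
  rewrite ler_norml -/(g k x) -/d; lra.
have -> : 2 * c * K%:R * (t - s) ^+ 2 = C * (t - s) by rewrite expr2 mulrA.
rewrite ler_norml; lra.
Qed.

(** The path and the integral of its drift both follow [(t - s) delta] up to a quadratic error, so
    their difference is flat. *)
Lemma flow_solution {R : realType} (c : R) (K : nat) (a : nat -> R -> R) :
  0 < c -> is_flow c K a -> solves_int_eq c K a.
Proof.
move=> c0 [a0 an al a2] k kK; set g := fun s => delta c K k (fun i => a i s).
have gl s t : 0 <= s -> s <= t -> t <= 1 -> `|g t - g s| <= 2 * c * K%:R * (t - s).
  by move=> s0 st t1; apply: delta_path_lipschitz.
have C0 : 0 <= 2 * c * K%:R by rewrite !mulr_ge0// ltW.
have gc : {within `[0, 1]%classic, continuous g}.
  apply/subspace_continuousP => x; rewrite /= in_itv/= => /andP[x0 x1].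
  apply/cvgrPdist_le => e e0; rewrite near_withinE.
  near=> y => /=; rewrite in_itv/= => /andP[y0 y1].
  (* The [+ 1] keeps the divisor visibly positive. *)
  have xy : `|x - y| <= e / (2 * c * K%:R + 1).
    near: y; apply: cvgr_dist_le => //; rewrite divr_gt0//; lra.
  apply: (@le_trans _ _ (2 * c * K%:R * `|x - y|)).
    have [xy'|/ltW xy'] := leP x y.
      by rewrite distrC (distrC x) (ger0_norm (_ : 0 <= y - x)) ?subr_ge0// gl.
    by rewrite (ger0_norm (_ : 0 <= x - y)) ?subr_ge0// gl.
  apply: (@le_trans _ _ ((2 * c * K%:R + 1) * `|x - y|)).
    by rewrite ler_wpM2r// lerDl.
  by rewrite -ler_pdivlMl ?ltr_wpDl// mulrC.
have gi : lebesgue_measure.-integrable `[0, 1]%classic (EFin \o g).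
  by apply: continuous_compact_integrable => //; exact: segment_compact.
split=> // t t01.
have [gt _ _] := Rintegral_increment g t t gi ltac:(lra) (lexx t) ltac:(lra).
rewrite -[RHS]fineK; last exact: integrable_fin_num.
congr EFin; apply/eqP; rewrite -subr_eq0; apply/eqP.
(* The factor 2 counts one quadratic error for the flow and one for the integral. *)
apply: (@flat_of_quadratic_increments R
  (fun t => a k t - \int[lebesgue_measure]_(s in `[0, t]) g s)
  (2 * (2 * c * K%:R))) => //.
- by rewrite mulr_ge0.
- by rewrite a0// set_itv1 Rintegral_set1 subrr.
move=> s u s0 su u1.
have [_ gsu gE] := Rintegral_increment g s u gi s0 su u1.
have := a2 k s u kK s0 su u1; rewrite -/(g s).
set d := g s; set C := 2 * c * K%:R in C0 gl *.
have : (d - C * (u - s)) * (u - s) <= \int[lebesgue_measure]_(x in `]s, u]) g x <= (d + C * (u - s)) * (u - s).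
  apply: Rintegral_itv_bounds => // x /andP[sx xu].
  have := gl s x s0 (ltW sx) (le_trans xu u1).
  have : C * (x - s) <= C * (u - s) by rewrite ler_wpM2l//; lra.
  rewrite ler_norml -/d; lra.
rewrite -gE !ler_norml expr2.
set I := \int[lebesgue_measure]_(x in `[0, u]) g x.
set J := \int[lebesgue_measure]_(x in `[0, s]) g x.
lra.
Unshelve. all: by end_near.
Qed.

(** * Existence by the Euler scheme *)

(** [u + 2C/2^m] decreases and [u - 2C/2^m] increases; the limit of the first lies between them,
    which also yields the rate. *)
Lemma geometric_cauchy {R : realType} (u : nat -> R) (C : R) : 0 <= C ->
  (forall m, `|u m.+1 - u m| <= C * 2^-1 ^+ m) ->
  exists l, forall m, `|u m - l| <= 2 * C * 2^-1 ^+ m.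
Proof.
move=> C0 H; set v := fun m => u m + 2 * C * 2^-1 ^+ m.
set w := fun m => u m - 2 * C * 2^-1 ^+ m.
have h0 m : 0 <= 2 * C * 2^-1 ^+ m :> R by rewrite !mulr_ge0 ?exprn_ge0.
have vd : {homo v : n m / (n <= m)%N >-> m <= n}.
  apply/nonincreasing_seqP => m; have := H m; rewrite /v exprS ler_norml; lra.
have wi : {homo w : n m / (n <= m)%N >-> n <= m}.
  apply/nondecreasing_seqP => m; have := H m; rewrite /w exprS ler_norml; lra.
have wv m p : w m <= v p.
  apply: (le_trans (wi m (maxn m p) (leq_maxl _ _))).
  apply: le_trans (vd p (maxn m p) (leq_maxr _ _)).
  by rewrite /w /v; have := h0 (maxn m p); lra.
have vlb : has_lbound (range v) by exists (w 0%N) => _ [p _ <-].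
have vc := nonincreasing_is_cvgn vd vlb.
exists (limn v) => m; have l1 := nonincreasing_cvgn_ge vd vc m.
have l2 : w m <= limn v by apply: limr_ge => //; apply: nearW.
by move: l1 l2; rewrite /v /w ler_norml; lra.
Qed.

Lemma le0_of_le_half {R : realType} (x C : R) : 0 <= C ->
  (forall m : nat, x <= C * 2^-1 ^+ m) -> x <= 0.
Proof.
move=> C0 H; apply: (@le0_of_le_divS R _ C) => N; apply: (le_trans (H N)).
rewrite ler_wpM2l// exprVn lef_pV2 ?posrE ?exprn_gt0//.
by rewrite -natrX ler_nat ltn_expl.
Qed.

Fixpoint euler {R : realType} (c : R) (K : nat) (h : R) (i : nat) : nat -> R :=
  match i with
  | 0 => fun=> 0
  | i'.+1 => fun k => euler c K h i' k + h * delta c K k (euler c K h i')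
  end.

Lemma euler_nonneg {R : realType} (c : R) (K : nat) (h : R) (i : nat) :
  0 < c -> 0 <= h -> nonneg K (euler c K h i).
Proof.
move=> c0 h0; elim: i => [//|i IH] k kK /=.
by rewrite addr_ge0 ?IH// mulr_ge0//; have /andP[] := delta_itv c K k _ c0 kK IH.
Qed.

Lemma euler_increment {R : realType} (c : R) (K : nat) (h : R) (i j k : nat) :
  0 < c -> 0 <= h -> (1 <= k <= K)%N ->
  `|euler c K h (i + j) k - euler c K h i k| <= j%:R * h.
Proof.
move=> c0 h0 kK; elim: j => [|j IH]; first by rewrite addn0 subrr normr0 mul0r.
rewrite addnS /= addrAC (le_trans (ler_normD _ _))//.
have d01 := delta_itv c K k _ c0 kK (euler_nonneg c K h (i + j) c0 h0).
rewrite -natr1 mulrDl mul1r lerD// ger0_norm; first by rewrite ler_piMr//; lra.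
by rewrite mulr_ge0//; lra.
Qed.

(** After [j] steps the drift is off by at most [2 c K j h], so the next step adds [2 c K j h^2] to
    the error, and [j^2 + j <= (j+1)^2]. *)
Lemma euler_quadratic {R : realType} (c : R) (K : nat) (h : R) (i j k : nat) :
  0 < c -> 0 <= h -> (1 <= k <= K)%N ->
  `|euler c K h (i + j) k - euler c K h i k - j%:R * h * delta c K k (euler c K h i)|
  <= 2 * c * K%:R * (j%:R * h) ^+ 2.
Proof.
move=> c0 h0 kK.
have C0 : 0 <= 2 * c * K%:R by rewrite !mulr_ge0// ltW.
elim: j => [|j IH].
  by rewrite addn0 subrr !mul0r subrr normr0 expr2 mul0r mulr0.
rewrite addnS /= -natr1.
have hd := delta_lipschitz c K k _ _ c0 kK (euler_nonneg c K h (i + j) c0 h0)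
  (euler_nonneg c K h i c0 h0).
have hl : l1 K (euler c K h (i + j)) (euler c K h i) <= K%:R * (j%:R * h).
  by apply: l1_le => l lK; apply: euler_increment.
set e := euler c K h (i + j) k in IH *; set e0 := euler c K h i k in IH *.
set d := delta c K k (euler c K h (i + j)) in hd *.
set d0 := delta c K k (euler c K h i) in IH hd *.
have -> : e + h * d - e0 - (j%:R + 1) * h * d0 = (e - e0 - j%:R * h * d0) + h * (d - d0) by ring.
apply: (le_trans (ler_normD _ _)).
have hd' : h * `|d - d0| <= h * (2 * c * K%:R * (j%:R * h)).
  rewrite ler_wpM2l//; apply: (le_trans hd).
  by rewrite -[leRHS]mulrA ler_wpM2l// mulr_ge0// ltW.
rewrite normrM (ger0_norm h0).
have : 0 <= j%:R * (h * h) :> R by rewrite !mulr_ge0.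
have : 0 <= h * h by rewrite mulr_ge0.
set J := j%:R in IH hd' *; move=> p1 p2.
apply: (le_trans (lerD IH hd')).
have := mulr_ge0 C0 p1; have := mulr_ge0 C0 p2; rewrite !expr2; lra.
Qed.

(** Two half steps make one step of mesh [h] with local error [2 c K h^2], while the coarse scheme
    has no local error. *)
Lemma euler_refine {R : realType} (c : R) (K : nat) (h : R) (N : nat) :
  0 < c -> 0 <= h -> N%:R * h <= 1 ->
  l1 K (euler c K h N) (euler c K (h / 2) (N * 2))
  <= 2 * K%:R * (2 * c * K%:R) * expR (2 * c * K%:R) * h.
Proof.
move=> c0 h0 Nh.
have C0 : 0 <= 2 * c * K%:R by rewrite !mulr_ge0// ltW.
have h2 : 0 <= h / 2 by lra.
apply: (@euler_compare R c K (euler c K h) (fun i => euler c K (h / 2) (i * 2))) => //.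
- by move=> i _; split; apply: euler_nonneg.
move=> i k iN kK; split.
  rewrite /= (_ : _ - _ = 0); last by ring.
  by rewrite normr0 mulr_ge0// exprn_ge0.
have := euler_quadratic c K (h / 2) (i * 2) 2 k c0 h2 kK.
have -> : 2 * (h / 2) = h by field.
by rewrite -mulSnr.
Qed.

(** The bit [b] is the next binary digit: it says which half of its dyadic cell contains the
    point. *)
Lemma truncn_double {R : realType} (x : R) : 0 <= x ->
  exists b : bool, Num.truncn (2 * x) = (Num.truncn x * 2 + b)%N.
Proof.
move=> x0; have := truncn_itv x0; rewrite -natr1 => /andP[l u].
exists ((Num.truncn x)%:R + 2^-1 <= x); apply: truncn_def.
rewrite -[in ltRHS]natr1 natrD natrM.
by have [h|h] := leP ((Num.truncn x)%:R + 2^-1) x; rewrite ?mulr1n ?mulr0n; lra.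
Qed.

(** [x m t] is the Euler scheme of mesh [2^-m] stopped at the last grid point before [t]. Successive
    meshes differ by [O(2^-m)], and the defining bounds of a flow pass to the limit with errors of
    that order. *)
Lemma flow_exists {R : realType} (c : R) (K : nat) : 0 < c ->
  exists a : nat -> R -> R, is_flow c K a.
Proof.
move=> c0; set h := fun m => 2^-1 ^+ m : R.
set N := fun m (t : R) => Num.truncn (2 ^+ m * t).
set x := fun m t => euler c K (h m) (N m t).
have h0 m : 0 <= h m by rewrite exprn_ge0.
have h1 m : h m <= 1 by rewrite exprn_ile1//; lra.
have hN m t : 0 <= t -> t - h m <= (N m t)%:R * h m <= t.
  move=> t0; have p : 0 < 2 ^+ m :> R by rewrite exprn_gt0.
  have t0' : 0 <= 2 ^+ m * t by rewrite mulr_ge0// ltW.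
  have /andP[l u] := truncn_itv t0'.
  have -> : h m = (2 ^+ m)^-1 by rewrite /h exprVn.
  rewrite ler_pdivrMr// (mulrC t) l andbT ler_pdivlMr// mulrBl mulVf ?gt_eqF// (mulrC t).
  move: u; rewrite -natr1 -/(N m t); lra.
set C := 2 * c * K%:R.
have C0 : 0 <= C by rewrite !mulr_ge0// ltW.
(* The exponential term is the cost of halving the mesh; the 1 pays for the extra half step when the
   finer index is odd. *)
set B := 2 * K%:R * C * expR C + 1.
have B0 : 0 <= B by rewrite addr_ge0// mulr_ge0 ?expR_ge0// mulr_ge0.
have cauchy k t m : (1 <= k <= K)%N -> 0 <= t <= 1 ->
    `|x m.+1 t k - x m t k| <= B * h m.
  move=> kK /andP[t0 t1].
  have [b Nb] : exists b : bool, N m.+1 t = (N m t * 2 + b)%N.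
    by rewrite /N exprS -mulrA; apply: truncn_double; rewrite mulr_ge0// exprn_ge0.
  have hS : h m.+1 = h m / 2 by rewrite /h exprSr.
  have Nm : (N m t)%:R * h m <= 1 by have := hN m t t0; lra.
  have := le_trans (ler_l1 K k _ _ kK) (euler_refine c K (h m) (N m t) c0 (h0 m) Nm).
  rewrite -/C -/(x m t) => l1.
  have := euler_increment c K (h m / 2) (N m t * 2) b k c0 ltac:(have := h0 m; lra) kK.
  rewrite -Nb -hS -/(x m.+1 t) hS => l2.
  have l3 : b%:R * (h m / 2) <= h m by case: (b); have := h0 m; rewrite ?mulr1n ?mulr0n; lra.
  rewrite /B mulrDl mul1r distrC.
  have := ler_normD (x m t k - euler c K (h m / 2) (N m t * 2) k)
    (euler c K (h m / 2) (N m t * 2) k - x m.+1 t k).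
  rewrite subrKA => /le_trans; apply; apply: lerD => //.
  by rewrite distrC (le_trans l2).
have [a aP] : exists a : nat -> R -> R, forall k t, (1 <= k <= K)%N -> 0 <= t <= 1 ->
    forall m, `|x m t k - a k t| <= 2 * B * h m.
  (* Limits are chosen pointwise, with the default 0 outside the relevant range of [k] and [t]. *)
  have H k t : exists l, (1 <= k <= K)%N -> 0 <= t <= 1 ->
      forall m, `|x m t k - l| <= 2 * B * h m.
    have [kK|kK] := boolP (1 <= k <= K)%N; last by exists 0.
    have [t01|t01] := boolP (0 <= t <= 1); last by exists 0.
    have [l lP] := geometric_cauchy (fun m => x m t k) B B0 (fun m => cauchy k t m kK t01).
    by exists l.
  exists (fun k t => sval (cid (H k t))) => k t kK t01.
  by case: (cid (H k t)) => l /= /(_ kK t01).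
have xn m t : nonneg K (x m t) by apply: euler_nonneg.
have an t : 0 <= t <= 1 -> nonneg K (a^~ t).
  move=> t01 k kK; rewrite -oppr_le0; apply: (@le0_of_le_half R _ (2 * B)) => [|m].
    by rewrite mulr_ge0.
  have := aP k t kK t01 m; rewrite ler_norml -/(h m); have := xn m t k kK; lra.
(* Rounding both times to the grid changes the elapsed time by at most one mesh. *)
have theta m s t : 0 <= s -> s <= t -> t <= 1 -> exists2 j : nat, N m t = (N m s + j)%N &
    t - s - h m <= j%:R * h m <= t - s + h m.
  move=> s0 st t1; have NN : (N m s <= N m t)%N.
    by apply: le_truncn; rewrite ler_wpM2l// exprn_ge0.
  exists (N m t - N m s)%N; first by rewrite subnKC.
  rewrite natrB// mulrBl; have := hN m s s0; have := hN m t (le_trans s0 st); lra.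
exists a; split=> //.
- move=> k kK; apply/eqP; rewrite -normr_le0.
  apply: (@le0_of_le_half R _ (2 * B)) => [|m]; first by rewrite mulr_ge0.
  have := aP k 0 kK ltac:(lra) m.
  by rewrite /x /N mulr0 truncn0 /= sub0r normrN.
- move=> k s t kK s0 st t1; rewrite -subr_le0.
  apply: (@le0_of_le_half R _ (4 * B + 1)) => [|m]; first lra.
  have [j Nj] := theta m s t s0 st t1.
  have := aP k s kK ltac:(lra) m; have := aP k t kK ltac:(lra) m.
  have := euler_increment c K (h m) (N m s) j k c0 (h0 m) kK.
  rewrite -Nj -/(x m s) -/(x m t) -/(h m) => e1 e2 e3 /andP[_ e4].
  rewrite lerBlDr ler_norml; move: e1 e2 e3; rewrite !ler_norml; lra.
- move=> k s t kK s0 st t1; rewrite -subr_le0.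
  (* [4 B] replaces the scheme by its limit at both ends, [2 C (2 B)] does so inside the drift over
     a duration at most 2, 1 is the rounding of the duration, and [3 C] its effect on the square. *)
  apply: (@le0_of_le_half R _ (3 * C + 4 * B + 1 + 2 * C * (2 * B))) => [|m].
    by have := mulr_ge0 C0 B0; lra.
  have [j Nj] := theta m s t s0 st t1.
  have sI : 0 <= s <= 1 by lra.
  have := aP k s kK sI m; have := aP k t kK ltac:(lra) m.
  have := euler_quadratic c K (h m) (N m s) j k c0 (h0 m) kK.
  rewrite -Nj -/(x m s) -/(x m t) -/(h m) -/C => e1 e2 e3 /andP[e4 e5].
  have := delta_lipschitz c K k _ _ c0 kK (xn m s) (an s sI).
  have /l1_le : forall k, (1 <= k <= K)%N -> `|x m s k - a k s| <= 2 * B * h m.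
    by move=> k' k'K; apply: aP.
  have d01 := delta_itv c K k _ c0 kK (an s sI).
  set d := delta c K k (x m s) in e1 *; set d0 := delta c K k (a^~ s) in d01 *.
  set l := l1 _ _ _; set th := j%:R * h m in e1 e4 e5 *.
  move=> ll dd.
  have dd' : `|d - d0| <= C * (2 * B * h m).
    by apply: (le_trans dd); rewrite /C -[leRHS]mulrA ler_wpM2l// mulr_ge0// ltW.
  have th0 : 0 <= th by rewrite mulr_ge0.
  have hm0 := h0 m; have hm1 := h1 m.
  have th2 : th <= 2 by lra.
  have E1 : th * `|d - d0| <= 2 * (C * (2 * B * h m)) by rewrite ler_pM.
  have E2 : `|(th - (t - s)) * d0| <= h m * 1.
    rewrite normrM ler_pM//; first by rewrite ler_norml; lra.
    by rewrite ger0_norm; lra.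
  have E3 : C * th ^+ 2 <= C * ((t - s) ^+ 2 + 3 * h m).
    rewrite ler_wpM2l//; apply: (@le_trans _ _ ((t - s + h m) ^+ 2)).
      by rewrite lerXn2r ?nnegrE//; lra.
    have := ler_wpM2r hm0 hm1; have := ler_wpM2r hm0 (_ : t - s <= 1); rewrite !expr2.
    move=> /(_ ltac:(lra)); lra.
  have -> : a k t - a k s - (t - s) * d0 =
     (x m t k - x m s k - th * d) - (x m t k - a k t) + (x m s k - a k s)
     + th * (d - d0) + (th - (t - s)) * d0 by ring.
  have := ler_normD (x m t k - x m s k - th * d - (x m t k - a k t) + (x m s k - a k s)
     + th * (d - d0)) ((th - (t - s)) * d0).
  have := ler_normD (x m t k - x m s k - th * d - (x m t k - a k t) + (x m s k - a k s))
     (th * (d - d0)).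
  have := ler_normD (x m t k - x m s k - th * d - (x m t k - a k t)) (x m s k - a k s).
  have := ler_normB (x m t k - x m s k - th * d) (x m t k - a k t).
  rewrite [`|th * (d - d0)|]normrM (ger0_norm th0); lra.
Qed.

(** * The product measure on edges *)

(** The law of a single entry. Entries off [i < j] are deterministic, so the weight is a full
    product over all ordered pairs. *)
Definition edge_law {R : realType} (n : nat) (p : R) (ij : 'I_n * 'I_n) (b : bool) : R :=
  if (ij.1 < ij.2)%N then (if b then p else 1 - p) else (if b then 0 else 1).

(** Expectation over the edges alone, that is, conditionally on the selection order. *)
Definition Ee {R : realType} (n : nat) (p : R)
    (X : {ffun 'I_n * 'I_n -> bool} -> R) : R :=
  \sum_(e : {ffun 'I_n * 'I_n -> bool}) (\prod_ij edge_law n p ij (e ij)) * X e.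

Lemma Ex_Ee {R : realType} (n : nat) (p : R) (X : omega n -> R) :
  Ex p X = (n`!%:R)^-1 * \sum_s Ee n p (fun e => X (s, e)).
Proof.
rewrite mulr_sumr /Ex /Ee.
transitivity (\sum_(w : omega n) weight p (w.1, w.2) * X (w.1, w.2)).
  by apply: eq_bigr => -[].
rewrite -(pair_bigA _ (fun s e => weight p (s, e) * X (s, e)))/=.
apply: eq_bigr => s _; rewrite mulr_sumr; apply: eq_bigr => e _.
by rewrite /weight mulrA.
Qed.

Lemma edge_law_sum {R : realType} (n : nat) (p : R) (ij : 'I_n * 'I_n) :
  \sum_b edge_law n p ij b = 1.
Proof. rewrite big_bool /edge_law; case: ifP => _ /=; ring. Qed.

(** Independence of the entries, by distributivity of products over sums. *)
Lemma Ee_prod {R : realType} (n : nat) (p : R) (g : 'I_n * 'I_n -> bool -> R) :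
  Ee n p (fun e => \prod_ij g ij (e ij)) = \prod_ij \sum_b edge_law n p ij b * g ij b.
Proof.
rewrite bigA_distr_bigA /Ee; apply: eq_bigr => e _.
by rewrite -big_split.
Qed.

Lemma Ee_cst {R : realType} (n : nat) (p x : R) : Ee n p (fun=> x) = x.
Proof.
rewrite /Ee -mulr_suml -(bigA_distr_bigA (edge_law n p)) big1 ?mul1r// => ij _.
exact: edge_law_sum.
Qed.

Lemma EeD {R : realType} (n : nat) (p : R) X Y :
  Ee n p (fun e => X e + Y e) = Ee n p X + Ee n p Y.
Proof. by rewrite /Ee -big_split; apply: eq_bigr => e _; rewrite mulrDr. Qed.

Lemma EeZ {R : realType} (n : nat) (p a : R) X :
  Ee n p (fun e => a * X e) = a * Ee n p X.
Proof. by rewrite /Ee mulr_sumr; apply: eq_bigr => e _; rewrite mulrCA. Qed.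

Lemma Ee_sum {R : realType} (n : nat) (p : R) (I : Type) (r : seq I) X :
  Ee n p (fun e => \sum_(i <- r) X i e) = \sum_(i <- r) Ee n p (X i).
Proof. by rewrite /Ee exchange_big; apply: eq_bigr => e _; rewrite mulr_sumr. Qed.

Lemma edge_law_ge0 {R : realType} (n : nat) (p : R) ij b :
  0 <= p <= 1 -> 0 <= edge_law n p ij b.
Proof. by move=> /andP[p0 p1]; rewrite /edge_law; case: ifP => _; case: b; rewrite /= ?subr_ge0. Qed.

Lemma Ee_le {R : realType} (n : nat) (p : R) X Y : 0 <= p <= 1 ->
  (forall e, X e <= Y e) -> Ee n p X <= Ee n p Y.
Proof.
move=> p01 XY; apply: ler_sum => e _; rewrite ler_wpM2l//.
by apply: prodr_ge0 => ij _; apply: edge_law_ge0.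
Qed.

(** Averaging over [e'] with [e] fixed plays the role of conditioning on the entries outside [B]. *)
Definition splice {n : nat} (B : pred ('I_n * 'I_n)) (e e' : {ffun 'I_n * 'I_n -> bool}) :
  {ffun 'I_n * 'I_n -> bool} := [ffun ij => if B ij then e' ij else e ij].

(* The exchange, on [B], of the entries of two independent copies is an involution
   preserving the product measure. *)
Lemma Ee_resample {R : realType} (n : nat) (p : R) (B : pred ('I_n * 'I_n)) X :
  Ee n p X = Ee n p (fun e => Ee n p (fun e' => X (splice B e e'))).
Proof.
set w := fun e : {ffun 'I_n * 'I_n -> bool} => \prod_ij edge_law n p ij (e ij).
have -> : Ee n p X = Ee n p (fun e => Ee n p (fun=> X e)).
  by rewrite /Ee; under [RHS]eq_bigr do rewrite [X in _ * X]Ee_cst.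
transitivity (\sum_(q : {ffun 'I_n * 'I_n -> bool} * {ffun 'I_n * 'I_n -> bool})
    w q.1 * w q.2 * X q.1).
  rewrite -(pair_bigA _ (fun e e' => w e * w e' * X e))/=; apply: eq_bigr => e _.
  by rewrite /Ee mulr_sumr; apply: eq_bigr => e' _; rewrite mulrA.
transitivity (\sum_(q : {ffun 'I_n * 'I_n -> bool} * {ffun 'I_n * 'I_n -> bool})
    w q.1 * w q.2 * X (splice B q.1 q.2)); last first.
  rewrite -(pair_bigA _ (fun e e' => w e * w e' * X (splice B e e')))/=; apply: eq_bigr => e _.
  by rewrite /Ee mulr_sumr; apply: eq_bigr => e' _; rewrite mulrA.
rewrite (reindex_inj (h := fun q => (splice B q.1 q.2, splice B q.2 q.1)))/=.
  apply: eq_bigr => -[e e'] _ /=; congr (_ * _); rewrite /w -!big_split/=.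
  apply: eq_bigr => ij _; rewrite !ffunE; case: ifP => // _; exact: mulrC.
apply: (can_inj (g := fun q => (splice B q.1 q.2, splice B q.2 q.1))) => -[e e'] /=.
by congr pair; apply/ffunP => ij; rewrite !ffunE; case: (B ij).
Qed.

(** [phi] sends [x] to the ordered pair that stores the edge between [v] and [x]. It is injective on
    [T], so the event is a product of functions of distinct entries, each absent with probability
    [1 - p]. *)
Lemma Ee_no_edge {R : realType} (n : nat) (p : R) (v : 'I_n) (T : {set 'I_n}) :
  v \notin T ->
  Ee n p (fun e => [forall x in T, ~~ adj e v x]%:R) = (1 - p) ^+ #|T|.
Proof.
move=> vT; set phi := fun x : 'I_n => if (x < v)%N then (x, v) else (v, x).
have vx x : x \in T -> x != v by move=> xT; apply: contraNneq vT => <-.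
have adjE e x : x \in T -> adj e v x = e (phi x).
  move=> /vx; rewrite /adj /phi -val_eqE/=; case: ltngtP => // ->.
have phi_lt x : x \in T -> ((phi x).1 < (phi x).2)%N.
  by move=> /vx; rewrite /phi neq_ltn; case: ifP => // ->.
have phi_inj : {in T &, injective phi}.
  move=> x y /vx xv /vx yv; rewrite /phi; case: ifP => _; case: ifP => _ [].
  - by [].
  - by move=> xv'; rewrite xv' eqxx in xv.
  - by move=> _ xv'; rewrite xv' eqxx in xv.
  - by [].
pose g := fun ij (b : bool) => if ij \in phi @: T then (~~ b)%:R else 1 : R.
have -> : (fun e => [forall x in T, ~~ adj e v x]%:R) = (fun e => \prod_ij g ij (e ij)) :> (_ -> R).
  apply/funext => e; rewrite /g -big_mkcond/=.
  have [/forall_inP H|] := boolP [forall x in T, ~~ adj e v x].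
    rewrite big1// => ij /imsetP[x xT ->]; rewrite -adjE//.
    by rewrite (H x xT).
  rewrite negb_forall_in => /exists_inP[x xT]; rewrite negbK adjE// => ex.
  by rewrite (bigD1 (phi x))/= ?imset_f// ex mul0r.
rewrite Ee_prod -(card_in_imset phi_inj) -prodr_const [RHS]big_mkcond/=.
apply: eq_bigr => ij _; rewrite /g; case: ifP => [/imsetP[x xT ->]|_].
  by rewrite big_bool /edge_law phi_lt//= mulr0 mulr1 add0r.
by rewrite -[RHS](edge_law_sum n p ij); apply: eq_bigr => b _; rewrite mulr1.
Qed.

(** * One step of the exploration *)

Definition new_height (n K : nat) (s : {set 'I_n} * {ffun 'I_n -> nat})
    (e : {ffun 'I_n * 'I_n -> bool}) (v : 'I_n) : nat :=
  let j := \max_(x in s.1 | adj e v x) s.2 x in if (j <= K.-1)%N then j.+1 else 0%N.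

Lemma expl_stateS (n K : nat) (w : omega n) (t : nat) (tn : (t < n)%N) :
  let s := expl_state K w t in let v := w.1 (Ordinal tn) in
  expl_state K w t.+1 =
    (v |: s.1, [ffun x => if x == v then new_height n K s w.2 v else s.2 x])%SET.
Proof. by rewrite /= /expl_step insubT. Qed.

(** The explored set is thus determined by the order alone; edges influence only the heights. *)
Lemma mem_explored (n K : nat) (w : omega n) (t : nat) (x : 'I_n) : (t <= n)%N ->
  (x \in (expl_state K w t).1) = ((w.1^-1)%g x < t)%N.
Proof.
elim: t => [|t IH] tn; first by rewrite inE ltn0.
rewrite expl_stateS /= in_setU1 IH ?(ltnW tn)// [in RHS]ltnS [in RHS]leq_eqVlt; congr (_ || _).
apply/eqP/eqP => [->|xt]; first by rewrite permK.
by rewrite -[LHS](permKV w.1); congr (w.1 _); apply: val_inj.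
Qed.

Lemma next_unexplored (n K : nat) (w : omega n) (t : nat) (tn : (t < n)%N) :
  w.1 (Ordinal tn) \notin (expl_state K w t).1.
Proof. by rewrite mem_explored ?(ltnW tn)// permK ltnn. Qed.

Lemma height_le (n K : nat) (w : omega n) (t : nat) (x : 'I_n) : (1 <= K)%N -> (t <= n)%N ->
  ((expl_state K w t).2 x <= K)%N.
Proof.
move=> K1; elim: t => [|t IH] tn; first by rewrite ffunE.
rewrite expl_stateS /= ffunE; case: eqP => _; last by rewrite IH// ltnW.
rewrite /new_height; case: ifP => //; lia.
Qed.

Lemma height_unexplored (n K : nat) (w : omega n) (t : nat) (x : 'I_n) : (t <= n)%N ->
  x \notin (expl_state K w t).1 -> (expl_state K w t).2 x = 0%N.
Proof.
elim: t => [|t IH] tn; first by rewrite ffunE.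
rewrite expl_stateS /= ffunE in_setU1; case: eqP => //= _; apply: IH; exact: ltnW.
Qed.

(** Unselected neighbours have height 0, which is neutral for the maximum, and [m < K] agrees with
    [m <= K - 1] because [K >= 1]. *)
Lemma tetris_h_expl (n K : nat) (w : omega n) (t : nat) : (1 <= K)%N -> (t <= n)%N ->
  tetris_h K w t = (expl_state K w t).2.
Proof.
move=> K1; elim: t => [//|t IH] tn.
rewrite expl_stateS /= /tetris_step insubT IH ?(ltnW tn)//=.
apply/ffunP => x; rewrite !ffunE; case: eqP => // _; rewrite /new_height.
have -> : \max_(y | adj w.2 (w.1 (Ordinal tn)) y) (expl_state K w t).2 y =
    \max_(y in (expl_state K w t).1 | adj w.2 (w.1 (Ordinal tn)) y) (expl_state K w t).2 y.
  rewrite [RHS]big_mkcond [LHS]big_mkcond/=; apply: eq_bigr => y _.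
  have [//|yS] := boolP (y \in (expl_state K w t).1).
  by rewrite (height_unexplored n K w t y (ltnW tn) yS) if_same.
by set m := \max_(y in _ | _) _; have -> : (m < K)%N = (m <= K.-1)%N by lia.
Qed.

(** The first [t] steps inspect only edges among the first [t] selected vertices. *)
Lemma expl_state_local (n K : nat) (s : {perm 'I_n}) e e' (t : nat) : (t <= n)%N ->
  (forall x y, ((s^-1)%g x < t)%N -> ((s^-1)%g y < t)%N -> adj e x y = adj e' x y) ->
  expl_state K (s, e) t = expl_state K (s, e') t.
Proof.
elim: t => [//|t IH] tn ee'.
have E : expl_state K (s, e) t = expl_state K (s, e') t.
  by apply: IH; [exact: ltnW|move=> x y xt yt; apply: ee'; exact: ltnW].
rewrite !expl_stateS /= E; congr pair; apply/ffunP => x; rewrite !ffunE.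
case: eqP => // _; rewrite /new_height; congr (if (_ <= _)%N then _.+1 else _);
  apply: eq_bigl => y; rewrite mem_explored ?(ltnW tn)//=.
all: by case: ltnP => // yt; apply: ee'; rewrite ?permK//= ltnS ltnW.
Qed.

Definition edges_at {n : nat} (v : 'I_n) : pred ('I_n * 'I_n) :=
  fun ij => (ij.1 == v) || (ij.2 == v).

Lemma adj_splice (n : nat) (v x y : 'I_n) e e' :
  adj (splice (edges_at v) e e') x y =
  if (x == v) || (y == v) then adj e' x y else adj e x y.
Proof.
rewrite /adj !ffunE /edges_at /=; case: ltngtP => _; case: (x == v); case: (y == v) => //.
Qed.

(** Freshness of the edges at the next vertex [v]: the past is a function of [e]. By
    [new_height_splice], the new height given the past is a function of [e']. *)
Lemma expl_state_splice (n K : nat) (s : {perm 'I_n}) e e' (t : nat) (tn : (t < n)%N) :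
  let v := s (Ordinal tn) in
  expl_state K (s, splice (edges_at v) e e') t =
  expl_state K (s, e) t.
Proof.
apply: expl_state_local => [|x y xt yt]; first exact: ltnW.
have H z : ((s^-1)%g z < t)%N -> (z == s (Ordinal tn)) = false.
  by move=> zt; apply/negbTE; apply: contraTneq zt => ->; rewrite permK ltnn.
by rewrite adj_splice !H.
Qed.

Lemma new_height_splice (n K : nat) s (v : 'I_n) e e' :
  new_height n K s (splice (edges_at v) e e') v =
  new_height n K s e' v.
Proof.
rewrite /new_height; congr (if (_ <= _)%N then _.+1 else _);
  by apply: eq_bigl => y; rewrite adj_splice eqxx.
Qed.

Lemma A_countS (n K : nat) (s : {perm 'I_n}) e k (t : nat) (tn : (t < n)%N) :
  A_count K (s, e) k t.+1 = (A_count K (s, e) k t +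
    (new_height n K (expl_state K (s, e) t) e (s (Ordinal tn)) == k))%N.
Proof.
have vS := next_unexplored n K (s, e) t tn; move: vS => /=.
rewrite /A_count expl_stateS /=; set S := expl_state K (s, e) t.
set v := s _; set hv := new_height _ _ _ _ _ => vS.
set A := [set x in S.1 | S.2 x == k]%SET.
have vA : v \notin A by rewrite inE (negbTE vS).
case: eqP => hk.
- rewrite addn1 -(add1n #|A|) -[1%N]/(true : nat) -vA -cardsU1; apply: eq_card => x.
  rewrite !inE !ffunE; case: eqP => //= _.
  by rewrite hk eqxx.
- rewrite addn0; apply: eq_card => x; rewrite !inE !ffunE; case: eqP => //= ->.
  by rewrite (negbTE vS); apply/eqP.
Qed.

(** Links the sets met by [Ee_no_edge] to the tail sums in which the drift is written. *)
Lemma card_tail (n K k : nat) (s : {set 'I_n} * {ffun 'I_n -> nat}) :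
  (forall x, (s.2 x <= K)%N) ->
  #|[set x in s.1 | (k <= s.2 x)%N]%SET| =
  (\sum_(k <= i < K.+1) #|[set x in s.1 | s.2 x == i]%SET|)%N.
Proof.
move=> sK; under eq_bigr do rewrite -sum1dep_card big_mkcond.
rewrite exchange_big/= -sum1dep_card big_mkcond/=; apply: eq_bigr => x _.
case: (x \in s.1) => /=; last by rewrite big1.
rewrite -big_mkcond/= sum1_count.
rewrite (eq_count (a2 := pred1 (s.2 x))); last by move=> i; rewrite /= eq_sym.
by rewrite count_uniq_mem ?iota_uniq// mem_index_iota ltnS sK andbT; case: leqP.
Qed.

(** The new height is [j+1] iff the maximum [m] over explored neighbours equals [j], and [m <= j]
    iff [v] has no edge to explored vertices higher than [j]. Subtracting the event [m <= j-1] gives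
    the formula; for [j = 0] nothing is subtracted. *)
Lemma new_height_prob {R : realType} (n K k : nat) (p : R)
    (s : {set 'I_n} * {ffun 'I_n -> nat}) (v : 'I_n) :
  (forall x, (s.2 x <= K)%N) -> (1 <= k <= K)%N -> v \notin s.1 ->
  let tail j := (\sum_(j <= i < K.+1) #|[set x in s.1 | s.2 x == i]%SET|)%N in
  Ee n p (fun e => (new_height n K s e v == k)%:R) =
  (1 - p) ^+ tail k - (if k == 1%N then 0 else (1 - p) ^+ tail k.-1).
Proof.
move=> sK kK vs tail.
pose T j := [set x in s.1 | (j <= s.2 x)%N]%SET.
have vT j : v \notin T j by rewrite inE (negbTE vs).
pose m e := (\max_(x in s.1 | adj e v x) s.2 x)%N.
have mT e j : [forall x in T j.+1, ~~ adj e v x] = (m e <= j)%N.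
  apply/idP/idP => [/forall_inP H|/bigmax_leqP H].
    apply/bigmax_leqP => x /andP[xs ex]; rewrite leqNgt; apply/negP => jx.
    by have := H x; rewrite inE xs jx ex => /(_ isT).
  apply/forall_inP => x; rewrite inE => /andP[xs jx]; apply/negP => ex.
  by have := H x; rewrite xs ex leqNgt jx => /(_ isT).
have E j : Ee n p (fun e => (m e <= j)%:R) = (1 - p) ^+ tail j.+1.
  rewrite /tail -card_tail// -(Ee_no_edge n p v (T j.+1) (vT _)).
  by apply: eq_bigr => e _; rewrite mT.
case: k kK => [//|j] jK.
have -> : (fun e => (new_height n K s e v == j.+1)%:R) =
    (fun e => (m e <= j)%:R + -1 * (if j == 0%N then 0 else (m e <= j.-1)%:R)) :> (_ -> R).
  apply/funext => e; rewrite /new_height -/(m e).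
  have -> : ((if (m e <= K.-1)%N then (m e).+1 else 0%N) == j.+1) = (m e == j).
    by case: ifP => [_|mK]; [rewrite eqSS|apply/esym/negbTE/eqP => mj; move: mK; rewrite mj; lia].
  case: j jK => [|j] jK /=; first by rewrite mulr0 addr0 leqn0.
  case: (ltngtP (m e) j.+1) => h; rewrite ?(ltnW h).
  - by rewrite -ltnS h mulr1 subrr.
  - by rewrite leqNgt (ltnW h) mulr0 addr0.
  - by rewrite h ltnn mulr0 addr0.
rewrite EeD EeZ E mulN1r eqSS; congr (_ - _).
by case: j jK => [|j] jK /=; [rewrite Ee_cst|rewrite E].
Qed.

(** * Mean square distance to the flow *)

Definition sqdist {R : realType} (K : nat) (x y : nat -> R) : R :=
  \sum_(1 <= k < K.+1) (x k - y k) ^+ 2.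

(** Cauchy-Schwarz against the constant 1, through [p q <= (p^2 + q^2)/2] for each pair of terms. *)
Lemma l1_sqr_le {R : realType} (K : nat) (x y : nat -> R) :
  l1 K x y ^+ 2 <= K%:R * sqdist K x y.
Proof.
rewrite expr2 /l1 big_distrlr /=.
apply: (@le_trans _ _ (\sum_(1 <= i < K.+1) \sum_(1 <= j < K.+1)
   (2^-1 * (x i - y i) ^+ 2 + 2^-1 * (x j - y j) ^+ 2))).
  apply: ler_sum => i _; apply: ler_sum => j _.
  rewrite -(real_normK (num_real (x i - y i))) -(real_normK (num_real (x j - y j))).
  set p := `|x i - y i|; set q := `|x j - y j|.
  have := sqr_ge0 (p - q); rewrite !expr2; lra.
under eq_bigr => i _ do rewrite big_split/= sum_nat1_const -mulr_sumr.
rewrite big_split/= -mulr_sumr sum_nat1_const -mulr_sumr -/(sqdist K x y); lra.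
Qed.

Lemma exprn_lipschitz {R : realType} (x y : R) (T : nat) : 0 <= x <= 1 -> 0 <= y <= 1 ->
  `|x ^+ T - y ^+ T| <= T%:R * `|x - y|.
Proof.
move=> /andP[x0 x1] /andP[y0 y1]; elim: T => [|T IH]; first by rewrite subrr normr0 mul0r.
rewrite !exprS -natr1 mulrDl mul1r.
have -> : x * x ^+ T - y * y ^+ T = x * (x ^+ T - y ^+ T) + (x - y) * y ^+ T by ring.
apply: (le_trans (ler_normD _ _)); rewrite !normrM; apply: lerD.
  by apply: le_trans IH; rewrite ler_piMl// ger0_norm.
by rewrite ler_piMr// ger0_norm ?exprn_ge0// exprn_ile1.
Qed.

(** Powers are [T]-Lipschitz on [[0, 1]], and [1 - p <= exp(-p) <= 1 - p + p^2]; the upper bound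
    follows from [(1 - p + p^2)(1 + p) = 1 + p^3]. *)
Lemma exprn_expR_approx {R : realType} (p : R) (T : nat) : 0 <= p <= 1 ->
  `|(1 - p) ^+ T - expR (- (p * T%:R))| <= T%:R * p ^+ 2.
Proof.
move=> /andP[p0 p1].
have -> : expR (- (p * T%:R)) = expR (- p) ^+ T by rewrite -expRM_natl -mulNr mulrC.
have e1 := expR_ge1Dx (- p); have e2 := expR_ge1Dx p; have e0 := expR_gt0 (- p).
have e3 : expR (- p) * expR p = 1 by rewrite -expRD addNr expR0.
have e4 : expR (- p) * (1 + p) <= 1 by rewrite -[leRHS]e3 ler_pM2l.
have e5 : expR (- p) <= 1 - p + p ^+ 2.
  rewrite -(ler_pM2r (_ : 0 < 1 + p)); last lra.
  apply: (le_trans e4).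
  have -> : (1 - p + p ^+ 2) * (1 + p) = 1 + p ^+ 3 by ring.
  by rewrite lerDl exprn_ge0.
apply: (le_trans (exprn_lipschitz (1 - p) (expR (- p)) T _ _)).
- lra.
- rewrite expR_ge0/=; nra.
by rewrite ler_wpM2l// ler_norml; lra.
Qed.

(** Each of the two powers is within [n (c/n)^2 = c^2/n] of its exponential. *)
Lemma drift_approx {R : realType} (c : R) (n K k : nat) (T : nat -> nat) (A : nat -> nat) :
  0 < c -> c <= n%:R -> (1 <= k <= K)%N ->
  (forall j, T j = \sum_(j <= i < K.+1) A i)%N -> (forall j, (T j <= n)%N) ->
  `|(1 - c / n%:R) ^+ T k - (if k == 1%N then 0 else (1 - c / n%:R) ^+ T k.-1)
    - delta c K k (fun i => (A i)%:R / n%:R)| <= 2 * c ^+ 2 / n%:R.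
Proof.
move=> c0 cn kK TE Tn.
have n0 : 0 < n%:R :> R by exact: lt_le_trans cn.
have p01 : 0 <= c / n%:R <= 1.
  by rewrite divr_ge0 ?(ltW c0) ?(ltW n0)//= ler_pdivrMr// mul1r.
rewrite delta_tail//.
have H j : `|(1 - c / n%:R) ^+ T j - expR (- (c * \sum_(j <= i < K.+1) (A i)%:R / n%:R))|
    <= c ^+ 2 / n%:R.
  have -> : c * \sum_(j <= i < K.+1) (A i)%:R / n%:R = c / n%:R * (T j)%:R.
    by rewrite TE natr_sum -mulr_suml mulrCA mulrC.
  apply: (le_trans (exprn_expR_approx _ _ p01)).
  have -> : c ^+ 2 / n%:R = n%:R * (c / n%:R) ^+ 2 by field; rewrite gt_eqF.
  by rewrite ler_wpM2r ?exprn_ge0 ?ler_nat//; case/andP: p01.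
have := H k; have := H k.-1; case: eqP => _.
  rewrite !subr0 -mulrA !ler_norml; have : 0 <= c ^+ 2 / n%:R by rewrite divr_ge0 ?exprn_ge0 ?ltW.
  lra.
rewrite -mulrA !ler_norml; lra.
Qed.

Lemma tail_count_le (n K k : nat) (w : omega n) (t : nat) : (1 <= K)%N -> (t <= n)%N ->
  (\sum_(k <= i < K.+1) A_count K w i t <= n)%N.
Proof.
move=> K1 tn; rewrite -(card_tail n K k (expl_state K w t)).
  by rewrite -[leqRHS]card_ord max_card.
by move=> x; apply: height_le.
Qed.

(** The first summand covers the product of the current distance with the [O(1/n^2)] drift error,
    the second the squared one-step deviations. *)
Definition variance_constant {R : realType} (c : R) (K : nat) : R :=
  2 * K%:R * (2 * c ^+ 2 + 2 * c * K%:R) * K%:R + 4 * K%:R.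

Lemma variance_constant_ge0 {R : realType} (c : R) (K : nat) :
  0 < c -> 0 <= variance_constant c K.
Proof.
move=> c0; have cK := mulr_ge0 (ltW c0) (ler0n R K); have c2 := sqr_ge0 c.
rewrite /variance_constant addr_ge0 ?mulr_ge0//; lra.
Qed.

Definition mean_sqdist {R : realType} (c : R) (K n : nat) (a : nat -> R -> R)
    (s : {perm 'I_n}) (t : nat) : R :=
  Ee n (c / n%:R) (fun e => sqdist K
    (fun k => (A_count K (s, e) k t)%:R / n%:R) (fun k => a k (t%:R / n%:R))).

Lemma variance_step {R : realType} (c : R) (K n : nat) (a : nat -> R -> R) (s : {perm 'I_n})
    (t : nat) :
  0 < c -> c <= n%:R -> (1 <= K)%N -> is_flow c K a -> (t < n)%N ->
  mean_sqdist c K n a s t.+1 <= (1 + 4 * c * K%:R * n%:R^-1) * mean_sqdist c K n a s t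
    + variance_constant c K * n%:R^-1 ^+ 2.
Proof.
move=> c0 cn K1 [a0 an al a2] tn.
have n0 : 0 < n%:R :> R by exact: lt_le_trans cn.
have p01 : 0 <= c / n%:R <= 1.
  by rewrite divr_ge0 ?(ltW c0) ?(ltW n0)//= ler_pdivrMr// mul1r.
set h := n%:R^-1; have h0 : 0 < h by rewrite invr_gt0.
have t01 : 0 <= (t%:R / n%:R : R) <= 1.
  by rewrite divr_ge0//= ler_pdivrMr// mul1r ler_nat ltnW.
have t1 : t.+1%:R / n%:R <= 1 :> R by rewrite ler_pdivrMr// mul1r ler_nat.
have tS : t.+1%:R / n%:R - t%:R / n%:R = h :> R by rewrite -mulrBl -natrB// subSnn mul1r.
have tle : t%:R / n%:R <= t.+1%:R / n%:R :> R by rewrite -subr_ge0 tS ltW.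
set v := s (Ordinal tn).
pose x e k : R := (A_count K (s, e) k t)%:R / n%:R.
pose y k := a k (t%:R / n%:R).
pose Q e := sqdist K (x e) y.
have xn e : nonneg K (x e) by move=> k _; rewrite divr_ge0.
have yn : nonneg K y := an _ t01.
(* With the edges at [v] resampled, the current deviation depends on [e] and the coming increment on
   [e']; the bound is then proved for each fixed [e]. *)
rewrite /mean_sqdist (Ee_resample _ _ (edges_at v)) -/(Q _).
apply: (@le_trans _ _ (Ee n (c / n%:R) (fun e =>
   (1 + 4 * c * K%:R * h) * Q e + variance_constant c K * h ^+ 2))); last first.
  by rewrite EeD EeZ Ee_cst.
apply: Ee_le => // e; set S := expl_state K (s, e) t.
pose D k := x e k - y k; pose dy k := a k (t.+1%:R / n%:R) - y k.
pose I k e' : R := (new_height n K S e' v == k)%:R.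
pose l := l1 K (x e) y.
have l0 : 0 <= l by apply: sumr_ge0.
have lK : l <= K%:R.
  rewrite -[leRHS]mulr1; apply: l1_le => k kK; rewrite ler_norml.
  have y1 : y k <= 1.
    have := al k 0 _ kK (lexx 0) (proj1 (andP t01)) (proj2 (andP t01)).
    by rewrite a0// !subr0 -/(y k) ler_norml; lra.
  have x1 : x e k <= 1.
    rewrite /x ler_pdivrMr// mul1r ler_nat -[leqRHS]card_ord; exact: max_card.
  have := yn k kK; have := xn e k kK; lra.
have dyh k : (1 <= k <= K)%N -> `|dy k| <= h.
  by move=> kK; rewrite -tS; apply: al => //; case/andP: t01.
have tailn j : (\sum_(j <= i < K.+1) A_count K (s, e) i t <= n)%N.
  by apply: tail_count_le => //; exact: ltnW.
(* Three errors: the exact one-step probability against [delta], [delta] at the process against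
   [delta] at the flow, and the quadratic error of the flow. *)
have drift k : (1 <= k <= K)%N -> `|h * Ee n (c / n%:R) (I k) - dy k| <=
    2 * c * l * h + (2 * c ^+ 2 + 2 * c * K%:R) * h ^+ 2.
  move=> kK; rewrite /I new_height_prob//; last 2 first.
  - by move=> z; apply: height_le => //; exact: ltnW.
  - exact: next_unexplored.
  set pi := (X in `|h * X - _|).
  have e1 : `|pi - delta c K k (x e)| <= 2 * c ^+ 2 * h.
    exact: (@drift_approx R c n K k (fun j => \sum_(j <= i < K.+1) A_count K (s, e) i t)%N
      (fun i => A_count K (s, e) i t)).
  have e2 := delta_lipschitz c K k _ _ c0 kK (xn e) yn; rewrite -/l in e2.
  have := a2 k _ _ kK (proj1 (andP t01)) tle t1; rewrite tS -/(y k) -/(dy k) => e3.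
  have -> : h * pi - dy k = h * (pi - delta c K k (x e)) +
    h * (delta c K k (x e) - delta c K k y) - (dy k - h * delta c K k y) by ring.
  apply: (le_trans (ler_normB _ _)).
  have := ler_normD (h * (pi - delta c K k (x e))) (h * (delta c K k (x e) - delta c K k y)).
  rewrite !normrM !(gtr0_norm h0).
  have := ler_wpM2l (ltW h0) e1; have := ler_wpM2l (ltW h0) e2.
  move: e3; rewrite !expr2; lra.
have -> : (fun e' => sqdist K
     (fun k => (A_count K (s, splice (edges_at v) e e') k t.+1)%:R / n%:R)
     (fun k => a k (t.+1%:R / n%:R))) =
   (fun e' => \sum_(1 <= k < K.+1) (D k + (h * I k e' - dy k)) ^+ 2).
  apply/funext => e'; apply: eq_bigr => k _; congr (_ ^+ 2).
  rewrite (A_countS _ _ _ _ _ _ tn) -/v /A_count expl_state_splice -/v -/S new_height_splice.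
  rewrite natrD /D /dy /x /I /A_count -/S /h; ring.
(* In the expanded square, [4 h^2] bounds the square of [h I - dy]; the remainder is affine in [I],
   so only the mean of [I] matters. *)
apply: (@le_trans _ _ (Ee n (c / n%:R) (fun e' => \sum_(1 <= k < K.+1)
    ((D k ^+ 2 - 2 * D k * dy k + 4 * h ^+ 2) + (2 * D k * h) * I k e')))).
  apply: Ee_le => // e'; rewrite !big_nat; apply: ler_sum => k kK'.
  have kK : (1 <= k <= K)%N by rewrite ltnS in kK'.
  have I01 : 0 <= I k e' <= 1 by rewrite /I; case: (_ == _); rewrite ?lexx ler01.
  have : `|h * I k e' - dy k| <= 2 * h.
    have := dyh k kK; rewrite !ler_norml => ?.
    have : 0 <= h * I k e' by rewrite mulr_ge0 ?(ltW h0)//; lra.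
    have : h * I k e' <= h * 1 by rewrite ler_wpM2l ?(ltW h0)//; lra.
    lra.
  move=> /(lerXn2r 2); rewrite !nnegrE => /(_ (normr_ge0 _)).
  rewrite real_normK ?num_real// => /(_ ltac:(lra)).
  set d := D k; set j := I k e'; set z := dy k; rewrite !expr2; lra.
rewrite Ee_sum; under eq_bigr do rewrite EeD EeZ Ee_cst.
apply: (@le_trans _ _ (\sum_(1 <= k < K.+1) ((D k ^+ 2 + 4 * h ^+ 2) +
   `|D k| * (2 * (2 * c * l * h + (2 * c ^+ 2 + 2 * c * K%:R) * h ^+ 2))))).
  rewrite !big_nat; apply: ler_sum => k kK'.
  have kK : (1 <= k <= K)%N by rewrite ltnS in kK'.
  set E := Ee _ _ _.
  have : D k * (h * E - dy k) <= `|D k| * (2 * c * l * h + (2 * c ^+ 2 + 2 * c * K%:R) * h ^+ 2).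
    by apply: (le_trans (ler_norm _)); rewrite normrM ler_wpM2l// drift.
  lra.
rewrite big_split/= big_split/= sum_nat1_const -mulr_suml -/(sqdist K (x e) y) -/(Q e).
rewrite -/(l1 K (x e) y) -/l /variance_constant.
(* The cross term [4 c h l^2] is turned into [4 c K h] times the squared distance, the growth rate
   in the claim. *)
have := l1_sqr_le K (x e) y; rewrite -/l -/(Q e) => lQ.
have lQ' : 4 * c * h * l ^+ 2 <= 4 * c * h * (K%:R * Q e).
  by rewrite ler_wpM2l// !mulr_ge0// ltW.
have b0 : 0 <= (2 * c ^+ 2 + 2 * c * K%:R) * h ^+ 2.
  apply: mulr_ge0; last exact: sqr_ge0.
  have := mulr_ge0 (ltW c0) (ler0n R K); have := sqr_ge0 c; lra.
have K1' : 1 <= K%:R :> R by rewrite ler1n.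
have lb := ler_wpM2r b0 lK.
have Kb : K%:R * ((2 * c ^+ 2 + 2 * c * K%:R) * h ^+ 2) <=
  K%:R * (K%:R * ((2 * c ^+ 2 + 2 * c * K%:R) * h ^+ 2)) by rewrite ler_wpM2l// ler_peMl.
move: lQ' lb Kb; rewrite !expr2; lra.
Qed.

(** Gronwall with step [1/n] from initial value 0; the bound is uniform in the order [s]. *)
Lemma variance_bound {R : realType} (c : R) (K n : nat) (a : nat -> R -> R) (s : {perm 'I_n})
    (t : nat) :
  0 < c -> c <= n%:R -> (1 <= K)%N -> is_flow c K a -> (t <= n)%N ->
  mean_sqdist c K n a s t <= variance_constant c K * expR (4 * c * K%:R) / n%:R.
Proof.
move=> c0 cn K1 fa tn.
have n0 : 0 < n%:R :> R by exact: lt_le_trans cn.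
apply: (@discrete_gronwall R (mean_sqdist c K n a s)).
- by rewrite !mulr_ge0// ltW.
- exact: variance_constant_ge0.
- by rewrite invr_ge0 ltW.
- by rewrite ler_pdivrMr// mul1r ler_nat.
- rewrite -[leRHS](Ee_cst n (c / n%:R) 0); apply: Ee_le.
    by rewrite divr_ge0 ?(ltW c0) ?(ltW n0)//= ler_pdivrMr// mul1r.
  move=> e; rewrite /sqdist big_nat big1// => k kK; case: fa => a0 _ _ _.
  have -> : A_count K (s, e) k 0 = 0%N.
    by apply/eqP; rewrite cards_eq0; apply/eqP/setP => z; rewrite !inE.
  by rewrite !mul0r a0 ?subrr ?expr2 ?mul0r//; lia.
by move=> i ti; apply: variance_step => //; exact: leq_trans tn.
Qed.

(** * Convergence *)

Lemma A_count_increment (n K : nat) (w : omega n) (k i j : nat) : (i + j <= n)%N ->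
  (A_count K w k i <= A_count K w k (i + j) <= A_count K w k i + j)%N.
Proof.
case: w => s e; elim: j => [|j IH] ij; first by rewrite !addn0 leqnn.
have ijn : (i + j < n)%N by rewrite -addnS.
have /andP[l u] := IH (ltnW ijn); rewrite addnS (A_countS _ _ _ _ _ _ ijn).
rewrite (leq_trans l (leq_addr _ _))/= addnS -addn1; apply: leq_add => //.
by case: (_ == _).
Qed.

(** With [j] the integer part of [i M / n], the grid index [j n / M] lies at most [n/M + 1] below
    [i]. *)
Lemma grid_point (n M i : nat) : (0 < n)%N -> (0 < M)%N -> (i <= n)%N ->
  exists2 j, (j <= M)%N & exists2 l, (i = (j * n) %/ M + l)%N & (l * M <= n + M)%N.
Proof.
move=> n0 M0 iN; exists ((i * M) %/ n)%N.
  by rewrite -[leqRHS](mulKn M n0) leq_div2r// leq_mul2r iN orbT.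
set j := ((i * M) %/ n)%N.
have j1 : (j * n <= i * M)%N by exact: leq_divM.
have j2 : (i * M < j * n + n)%N by rewrite -mulSnr ltn_ceil.
have i1 : ((j * n) %/ M <= i)%N by rewrite -(mulnK i M0) leq_div2r.
have i2 : (j * n < (j * n) %/ M * M + M)%N by rewrite -mulSnr ltn_ceil.
exists (i - (j * n) %/ M)%N; first by rewrite subnKC.
rewrite mulnBl; lia.
Qed.

(** Go back to the preceding grid time along both paths. Each moves at most [1/M + 1/n] over the [l]
    steps, and rounding [t] costs another [1/n]: in all [2/M + 3/n]. *)
Lemma path_close {R : realType} (c : R) (K n M : nat) (a : nat -> R -> R) (w : omega n) (d : R) :
  is_flow c K a -> (0 < n)%N -> (0 < M)%N -> 0 < d -> 2 / M%:R + 3 / n%:R <= d / 2 ->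
  (forall j, (j <= M)%N -> let i := ((j * n) %/ M)%N in
    sqdist K (fun k => (A_count K w k i)%:R / n%:R) (fun k => a k (i%:R / n%:R))
      < (d / 2) ^+ 2) ->
  forall k t, (1 <= k <= K)%N -> 0 <= t <= 1 -> `|a k t - alpha_n K w k t| < d.
Proof.
move=> [a0 an al _] n0 M0 d0 Mn H k t kK /andP[t0 t1].
have n0' : 0 < n%:R :> R by rewrite ltr0n.
have M0' : 0 < M%:R :> R by rewrite ltr0n.
have nt0 : 0 <= n%:R * t by rewrite mulr_ge0.
rewrite /alpha_n; set i := Num.truncn _.
have /andP[i1 i2] := truncn_itv nt0; rewrite -/i in i1 i2.
have iN : (i <= n)%N.
  by rewrite -(ler_nat R) (le_trans i1)// ler_piMr// ltW.
have [j jM [l il lM]] := grid_point n M i n0 M0 iN.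
set i' := ((j * n) %/ M)%N in il.
have := H j jM; rewrite /= -/i' => Hj.
have D : `|(A_count K w k i')%:R / n%:R - a k (i'%:R / n%:R)| < d / 2.
  rewrite -(ltr_pXn2r (n := 2)) ?nnegrE//; last by rewrite divr_ge0 ?ltW.
  rewrite real_normK ?num_real//; apply: le_lt_trans Hj.
  apply: (ler_term_sum 1 K.+1 k (fun k => ((A_count K w k i')%:R / n%:R - a k (i'%:R / n%:R)) ^+ 2)) => //.
  by move=> q; exact: sqr_ge0.
have ln : l%:R / n%:R <= M%:R^-1 + n%:R^-1 :> R.
  rewrite ler_pdivrMr// mulrDl mulVf ?gt_eqF// -(ler_pM2r M0') mulrDl mul1r mulrAC.
  by rewrite mulVf ?gt_eqF// mul1r -natrM -natrD ler_nat.
have /andP[A1 A2] : (A_count K w k i' <= A_count K w k i <= A_count K w k i' + l)%N.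
  by rewrite il; apply: A_count_increment; rewrite -il.
have A12 : `|(A_count K w k i)%:R / n%:R - (A_count K w k i')%:R / n%:R| <= l%:R / n%:R :> R.
  rewrite -mulrBl normrM [`|_^-1|]gtr0_norm ?invr_gt0//.
  by rewrite -natrB// ger0_norm// ler_wpM2r ?invr_ge0 ?(ltW n0')// ler_nat leq_subLR.
have ti : t - i'%:R / n%:R <= n%:R^-1 + l%:R / n%:R.
  rewrite lerBlDr -[X in X + _ + _]mul1r -!mulrDl ler_pdivlMr//.
  by move: i2; rewrite il -natr1 natrD; lra.
have ti0 : i'%:R / n%:R <= t.
  by rewrite ler_pdivrMr// mulrC (le_trans _ i1)// ler_nat il leq_addr.
have := al k _ t kK _ ti0 t1; rewrite divr_ge0// => /(_ isT) aa.
have E : a k t - (A_count K w k i)%:R / n%:R = (a k t - a k (i'%:R / n%:R))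
   - ((A_count K w k i')%:R / n%:R - a k (i'%:R / n%:R))
   - ((A_count K w k i)%:R / n%:R - (A_count K w k i')%:R / n%:R) by ring.
rewrite E.
apply: (le_lt_trans (ler_normB _ _)).
have := ler_normB (a k t - a k (i'%:R / n%:R)) ((A_count K w k i')%:R / n%:R - a k (i'%:R / n%:R)).
lra.
Qed.

Lemma Ex_dist_le {R : realType} (n : nat) (p : R) (X : omega n -> R) (l b : R) :
  0 <= p <= 1 -> (forall s, Ee n p (fun e => `|X (s, e) - l|) <= b) ->
  `|Ex p X - l| <= b.
Proof.
move=> p01 H; have N0 : (n`!%:R : R) != 0 by rewrite pnatr_eq0 -lt0n fact_gt0.
have -> : Ex p X - l = (n`!%:R)^-1 * \sum_(s : {perm 'I_n}) (Ee n p (fun e => X (s, e)) - l).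
  by rewrite Ex_Ee sumrB sumr_const card_Sn mulrBr -[l *+ _]mulr_natl mulKf.
rewrite normrM ger0_norm ?invr_ge0// mulrC ler_pdivrMr ?ltr0n ?fact_gt0//.
apply: (le_trans (ler_norm_sum _ _ _)).
have -> : b * n`!%:R = \sum_(s : {perm 'I_n}) b by rewrite sumr_const card_Sn mulr_natr.
apply: ler_sum => s _; apply: le_trans (H s).
have -> : Ee n p (fun e => X (s, e)) - l = Ee n p (fun e => X (s, e) - l).
  by rewrite -[in LHS](Ee_cst n p (- l)) -EeD.
rewrite ler_norml; apply/andP; split; last by apply: Ee_le => // e; exact: ler_norm.
rewrite -mulN1r -EeZ; apply: Ee_le => // e.
by rewrite mulN1r lerNl -normrN ler_norm.
Qed.

Lemma bounded_fun_le {R : realType} {T : Type} (F : T -> R) : bounded_fun F ->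
  exists2 B : R, 0 <= B & forall x, `|F x| <= B.
Proof.
move=> [M [_ HM]]; exists (Num.max (M + 1) 0); first by rewrite le_max lexx orbT.
by move=> x; apply: (HM _ _ x I); rewrite lt_max ltrDl ltr01.
Qed.

(** The expectation of [|F(alpha_n) - F(a)|] is at most [eps/2] from paths close at all grid times,
    plus [2 B] times the chance of a large grid distance. *)
Lemma process_cvg {R : realType} (c : R) (K : nat) (a : nat -> R -> R)
    (F : (nat -> R -> R) -> R) :
  0 < c -> (1 <= K)%N -> is_flow c K a -> bounded_fun F -> unif_continuous_functional K F ->
  (fun n : nat => Ex (c / n%:R) (fun w : omega n => F (alpha_n K w))) @ \oo --> F a.
Proof.
move=> c0 K1 fa Fb Fc.
have [B B_ge0 HB] := bounded_fun_le F Fb.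
apply/cvgrPdist_le => eps eps0.
have eps2 : 0 < eps / 2 by lra.
have [d d0 Hd] := Fc a _ eps2.
(* [M] gives [2/M <= d/4]; later [n >= 12/d] gives [3/n <= d/4]. *)
pose M := (Num.truncn (8 / d)).+1.
have Md : 2 / M%:R <= d / 4.
  have := ltW (truncnS_gt (8 / d)); rewrite -/M ler_pdivrMr//.
  rewrite ler_pdivrMr ?ltr0n//; lra.
pose V := variance_constant c K * expR (4 * c * K%:R).
have V0 : 0 <= V by rewrite mulr_ge0 ?expR_ge0 ?variance_constant_ge0.
(* [W/n] is the total Chebyshev bound over the [M+1] grid times, each contributing [V/n]. *)
pose W := 2 * B / (d / 2) ^+ 2 * (M.+1%:R * V).
near=> n; rewrite distrC.
have cn : c <= n%:R by near: n; exact: nbhs_infty_ger.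
have dn : 12 / d <= n%:R by near: n; exact: nbhs_infty_ger.
have Wn : 2 * W / eps <= n%:R by near: n; exact: nbhs_infty_ger.
have n0' : 0 < n%:R :> R by exact: lt_le_trans cn.
have n0 : (0 < n)%N by rewrite -(ltr0n R).
have p01 : 0 <= c / n%:R <= 1.
  by rewrite divr_ge0 ?(ltW c0) ?(ltW n0')//= ler_pdivrMr// mul1r.
have Mn : 2 / M%:R + 3 / n%:R <= d / 2.
  suff : 3 / n%:R <= d / 4 by lra.
  by move: dn; rewrite !ler_pdivrMr//; lra.
apply: Ex_dist_le => // s.
pose Q j e := sqdist K (fun k => (A_count K (s, e) k ((j * n) %/ M))%:R / n%:R)
    (fun k => a k (((j * n) %/ M)%:R / n%:R)).
have Q0 j e : 0 <= Q j e by apply: sumr_ge0 => k _; exact: sqr_ge0.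
have d2 : 0 < (d / 2) ^+ 2 by rewrite exprn_gt0// divr_gt0.
(* Chebyshev in pointwise form: if some [Q j e] reaches [(d/2)^2], the second term already exceeds
   the trivial bound [2 B]. *)
apply: (@le_trans _ _ (Ee n (c / n%:R)
    (fun e => eps / 2 + 2 * B / (d / 2) ^+ 2 * \sum_(0 <= j < M.+1) Q j e))).
  apply: Ee_le => // e.
  have S0 : 0 <= \sum_(0 <= j < M.+1) Q j e by apply: sumr_ge0.
  have [small|] := pselect (forall j, (j <= M)%N -> Q j e < (d / 2) ^+ 2).
    rewrite distrC; apply: (@le_trans _ _ (eps / 2)).
      by apply: ltW; apply: Hd; apply: (@path_close R c K n M).
    by rewrite lerDl mulr_ge0// divr_ge0 ?mulr_ge0// ltW.
  move=> /existsNP[j /not_implyP[jM /negP]]; rewrite -leNgt => Qj.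
  have SQ : (d / 2) ^+ 2 <= \sum_(0 <= j < M.+1) Q j e.
    by apply: (le_trans Qj); apply: (ler_term_sum 0 M.+1 j (Q^~ e)).
  have : 2 * B <= 2 * B / (d / 2) ^+ 2 * \sum_(0 <= j < M.+1) Q j e.
    by rewrite mulrAC ler_pdivlMr// ler_wpM2l// mulr_ge0.
  have := ler_normB (F (alpha_n K (s, e))) (F a).
  have := HB (alpha_n K (s, e)); have := HB a; lra.
rewrite EeD Ee_cst EeZ Ee_sum.
have : \sum_(0 <= j < M.+1) Ee n (c / n%:R) (Q j) <= M.+1%:R * (V / n%:R).
  have -> : M.+1%:R * (V / n%:R) = \sum_(0 <= j < M.+1) (V / n%:R).
    by rewrite sumr_const_nat subn0 mulr_natl.
  rewrite !big_nat; apply: ler_sum => j jM; apply: variance_bound => //.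
  by rewrite -[leqRHS](mulKn n (isT : 0 < M)%N) leq_div2r// leq_mul2r -ltnS (proj2 (andP jM)) orbT.
have C0 : 0 <= 2 * B / (d / 2) ^+ 2 by rewrite divr_ge0 ?mulr_ge0// ltW.
move=> /(ler_wpM2l C0) /(lerD (lexx (eps / 2))) /le_trans; apply.
have -> : 2 * B / (d / 2) ^+ 2 * (M.+1%:R * (V / n%:R)) = W / n%:R by rewrite /W !mulrA.
suff : W / n%:R <= eps / 2 by lra.
by move: Wn; rewrite !ler_pdivrMr//; lra.
Unshelve. all: by end_near.
Qed.

(** After [n] steps every vertex is explored, and the heights of the two processes agree. *)
Lemma N_count_alpha {R : realType} (n K k : nat) (w : omega n) : (1 <= k <= K)%N ->
  (N_count K w k)%:R / n%:R = alpha_n K w k 1 :> R.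
Proof.
move=> kK; rewrite /alpha_n mulr1 natrK; congr (_%:R / _).
rewrite /N_count /A_count tetris_h_expl//; last by lia.
apply: eq_card => x; rewrite !inE mem_explored//=.
by rewrite ltn_ord.
Qed.

Theorem theorem2 (R : realType) (c : R) (hc : 0 < c) (K : nat) (hK : (1 <= K)%N) :
  exists alpha : nat -> R -> R,
    (* alpha solves the integral equations on [0,1] ... *)
    solves_int_eq c K alpha /\
    (* ... and is the unique solution *)
    (forall beta : nat -> R -> R, solves_int_eq c K beta ->
       forall k t, (1 <= k <= K)%N -> 0 <= t <= 1 -> beta k t = alpha k t) /\
    (* convergence in distribution, uniformly on [0,1], of the process alpha^n *)
    (forall F : (nat -> R -> R) -> R,
       bounded_fun F -> unif_continuous_functional K F ->
       (fun n : nat => Ex (c / n%:R) (fun w : omega n => F (alpha_n K w)))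
         @ \oo --> F alpha) /\
    (* consequence: N_k(n)/n -> alpha_k(1) in distribution *)
    (forall k, (1 <= k <= K)%N ->
       forall f : R -> R, bounded_fun f -> continuous f ->
       (fun n : nat => Ex (c / n%:R)
                          (fun w : omega n => f ((N_count K w k)%:R / n%:R)))
         @ \oo --> f (alpha k 1)).

Proof.
have [a fa] := flow_exists c K hc.
exists a; split; first exact: flow_solution.
split.
  move=> b /(solution_flow c K b hc) fb k t kK t01.
  exact: (flow_unique c K b a hc fb fa).
split; first by move=> F Fb Fc; exact: process_cvg.
move=> k kK f fb fc.
under eq_fun => n do under eq_fun => w do rewrite N_count_alpha//.
(* Evaluation at level [k] and time 1 is a continuous functional: the radius [d] may depend on the
   path, so continuity of [f] at [x k 1] supplies it. *)
apply: (@process_cvg R c K a (fun x => f (x k 1))) => //.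
- have [B _ HB] := bounded_fun_le f fb; exists B; split; first exact: num_real.
  by move=> M BM x _; exact: le_trans (HB _) (ltW BM).
- move=> x eps eps0; have /cvgrPdist_lt/(_ _ eps0) := fc (x k 1).
  move=> /nbhs_ballP[d d0 Hd]; exists d => // g /(_ k 1 kK).
  rewrite ler01 lexx => /(_ isT) gd; exact: Hd.
Qed.
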